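(* Let $\psi^{(i)}_{j,k}$ be the periodized wavelets on $\mathbb{T}^d=\mathbb{R}^d/\mathbb{Z}^d$ associated with an orthonormal $0$-smooth wavelet basis of $\mathbb{R}^d$. (1) Let $c^i_{j,k}$ be a collection of coefficients indexed by $i\in\{1,\dots,2^d-1\}$, $j\ge 0$, $k\in\mathbb{Z}^d$ with $2^{-j}k\in[0,1)^d$, and let $\omega_j=\sup_{i,k}|c^i_{j,k}|$. If $(\omega_j)_{j\in\mathbb{N}}\in\ell^1$, then the wavelet series $$f=\sum_{j} f_j,\qquad f_j=\sum_{i,k}c^i_{j,k}\,\psi^{(i)}_{j,k},$$ is normally convergent (as a series in $j$, i.e. $\sum_j\sup_{x}|f_j(x)|<\infty$), so that it defines a bounded function. If additionally the wavelets are continuous, then $f$ is also continuous. (2) This condition is optimal, in the following sense: if $(\omega_j)_{j\in\mathbb{N}}$ is a non-negative sequence such that $\sum_{j\in\mathbb{N}}\omega_j=\infty$ and if the wavelets are piecewise continuous, then there exists a wavelet series $\sum_j\sum_{i,k}c^i_{j,k}\psi^{(i)}_{j,k}$ such that $$\sup_{i,k}|c^i_{j,k}|=\omega_j\quad\text{for all } j,$$ and which is nowhere locally bounded on $\mathbb{T}^d$.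
   Context: An orthonormal $r$-smooth ($r\ge 0$) wavelet basis on $\mathbb{R}^d$ is a collection of functions $\varphi$ and $\Psi^{(i)}$, $i\in\{1,\dots,2^d-1\}$, such that: $\varphi$, the $\Psi^{(i)}$ and all their partial derivatives up to order $r$ have fast decay (faster than any negative power of $1+|x|$); and the functions $\varphi(\cdot-k)$, $k\in\mathbb{Z}^d$, together with $2^{dj/2}\Psi^{(i)}(2^j\cdot-k)$, $j\in\mathbb{N}$, $k\in\mathbb{Z}^d$, $i\in\{1,\dots,2^d-1\}$, form an orthonormal basis of $L^2(\mathbb{R}^d)$. (For example the Haar system is $0$-smooth.) The periodized wavelets on $\mathbb{T}^d$ are $\psi^{(i)}_{j,k}(x)=\sum_{l\in\mathbb{Z}^d}\Psi^{(i)}(2^j(x-l)-k)$, for $i\in\{1,\dots,2^d-1\}$, $j\in\mathbb{N}$, $k\in\mathbb{Z}^d$ with $2^{-j}k\in[0,1)^d$ (no $L^2$ normalization is used). A wavelet series is nowhere locally bounded if there is no nonempty open set $U\subset\mathbb{T}^d$ such that its partial sums over scales $j\le J$ converge, as $J\to\infty$ and in the sense of distributions on $U$, to a function of $L^\infty(U)$. In particular, if the series converges in $L^2$, this means that its sum is not essentially bounded on any nonempty open set. *)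

(* Defs.v *)
From HB Require Import structures.
From mathcomp Require Import all_boot all_order all_algebra.
From mathcomp Require Import all_classical all_reals all_analysis.

Set Implicit Arguments.
Unset Strict Implicit.
Unset Printing Implicit Defensive.

Import Order.TTheory GRing.Theory Num.Theory.
Import numFieldNormedType.Exports.

Local Open Scope classical_set_scope.
Local Open Scope ring_scope.

Section measurable_rV.
Context {R : realType} (n : nat).

(* R carries its Borel sigma-algebra, and R^n the one generated by the
   coordinates. *)
Definition rV_coord (i : 'I_n) (x : 'rV[R]_n) : measurableTypeR R := x ord0 i.

Let rV_set0 : g_sigma_preimage rV_coord set0.
Proof. exact: sigma_algebra0. Qed.

Let rV_setC A : g_sigma_preimage rV_coord A -> g_sigma_preimage rV_coord (~` A).
Proof. exact: sigma_algebraC. Qed.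

Let rV_bigcup (F : (set 'rV[R]_n)^nat) :
  (forall i, g_sigma_preimage rV_coord (F i)) ->
  g_sigma_preimage rV_coord (\bigcup_i F i).
Proof. exact: sigma_algebra_bigcup. Qed.

HB.instance Definition _ := @isMeasurable.Build default_measure_display
  'rV[R]_n (g_sigma_preimage rV_coord) rV_set0 rV_setC rV_bigcup.

End measurable_rV.

Section measurable_rV_lemmas.
Context {R : realType}.

Lemma measurable_rV_coord n (i : 'I_n) :
  measurable_fun [set: 'rV[R]_n] (rV_coord i).
Proof.
move=> _ Y mY; rewrite setTI; apply: sub_sigma_algebra => /=.
rewrite -bigcup_seq/=; exists i => /=; first by rewrite mem_index_enum.
by exists Y => //; rewrite setTI.
Qed.

Lemma measurable_fun_rVP d (T : measurableType d) n (f : T -> 'rV[R]_n) :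
  (forall i, measurable_fun [set: T] (rV_coord i \o f)) ->
  measurable_fun [set: T] f.
Proof.
move=> mf.
suff H : preimage_set_system setT f (g_sigma_preimage (@rV_coord R n))
    `<=` measurable.
  by move=> _ A mA; apply: H; exists A.
rewrite -[X in X `<=` _](g_sigma_preimage_comp (@rV_coord R n)).
apply: smallest_sub; first exact: sigma_algebra_measurable.
rewrite -bigcup_seq; apply: bigcup_sub => i _.
by move=> A [B mB <-]; exact: mf.
Qed.

Definition rV_cons n (p : measurableTypeR R * 'rV[R]_n) : 'rV[R]_n.+1 :=
  \row_i oapp (fun j => p.2 ord0 j) p.1 (unlift ord0 i).

Definition rV_uncons n (x : 'rV[R]_n.+1) : measurableTypeR R * 'rV[R]_n :=
  (x ord0 ord0, \row_j x ord0 (lift ord0 j)).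

Lemma measurable_rV_cons n : measurable_fun setT (@rV_cons n).
Proof.
apply: measurable_fun_rVP => i.
case: (unliftP ord0 i) => [j|] ->.
- rewrite (_ : _ \o _ = rV_coord j \o snd).
    exact: measurableT_comp (measurable_rV_coord j) measurable_snd.
  by apply/funext => p; rewrite /rV_coord/= mxE liftK.
- rewrite (_ : _ \o _ = fst); first exact: measurable_fst.
  by apply/funext => p; rewrite /rV_coord/= mxE unlift_none.
Qed.

Lemma measurable_rV_uncons n : measurable_fun setT (@rV_uncons n).
Proof.
apply/measurable_fun_pair => /=.
  exact: (@measurable_rV_coord n.+1 ord0).
apply: measurable_fun_rVP => j.
rewrite (_ : _ \o _ = rV_coord (lift ord0 j)).
  exact: measurable_rV_coord.
by apply/funext => x; rewrite /rV_coord/= mxE.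
Qed.

Lemma rV_consK n : cancel (@rV_cons n) (@rV_uncons n).
Proof.
move=> [a v]; rewrite /rV_uncons mxE unlift_none /=; congr pair.
by apply/rowP => j; rewrite !mxE liftK.
Qed.

Lemma rV_unconsK n : cancel (@rV_uncons n) (@rV_cons n).
Proof.
move=> x; apply/rowP => i; rewrite mxE.
by case: (unliftP ord0 i) => [j|] -> /=; rewrite ?liftK ?unlift_none //= mxE.
Qed.

End measurable_rV_lemmas.

Section lebesgue_rV.
Context {R : realType}.
Local Open Scope ereal_scope.

Section step.
Variables (n : nat) (mu : {sigma_finite_measure set 'rV[R]_n -> \bar R}).

Definition lebesgue_rV_step : set 'rV[R]_n.+1 -> \bar R :=
  pushforward (lebesgue_measure \x mu) (@rV_cons R n).

Let lebesgue_rV_step0 : lebesgue_rV_step set0 = 0.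
Proof. by rewrite /lebesgue_rV_step /pushforward preimage_set0 measure0. Qed.

Let lebesgue_rV_step_ge0 A : 0 <= lebesgue_rV_step A.
Proof. exact: (measure_ge0 (lebesgue_measure \x mu)). Qed.

Let lebesgue_rV_step_sigma_additive : semi_sigma_additive lebesgue_rV_step.
Proof.
exact: (@measure_semi_sigma_additive _ _ _
  (measure_function_pushforward__canonical__measure_function_Measure
     (lebesgue_measure \x mu) (@measurable_rV_cons R n))).
Qed.

HB.instance Definition _ := isMeasure.Build _ _ _ lebesgue_rV_step
  lebesgue_rV_step0 lebesgue_rV_step_ge0 lebesgue_rV_step_sigma_additive.

Let lebesgue_rV_step_sigma_finite : sigma_finite setT lebesgue_rV_step.
Proof.
have /sigma_finiteP[F [TF ndF Foo]] :=
  sigma_finiteT (@lebesgue_measure R : {sigma_finite_measure set _ -> \bar R}).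
have /sigma_finiteP[G [TG ndG Goo]] := sigma_finiteT mu.
exists (fun k => @rV_uncons R n @^-1` (F k `*` G k)).
  rewrite -preimage_bigcup (_ : \bigcup_k _ = setT) ?preimage_setT//.
  rewrite -setXTT TF TG; apply/seteqP; split.
    by move=> -[x y] [k _ [Fx Gy]]; split; exists k.
  move=> -[x y] [/= [k _ Fkx] [l _ Gly]]; exists (maxn k l) => //; split.
  - by move: x Fkx; exact/subsetPset/ndF/leq_maxl.
  - by move: y Gly; exact/subsetPset/ndG/leq_maxr.
move=> k; have [mFk Fk] := Foo k; have [mGk Gk] := Goo k; split.
  rewrite -[X in measurable X]setTI; apply: measurable_rV_uncons => //.
  exact: measurableX.
rewrite /lebesgue_rV_step /pushforward -comp_preimage.
rewrite (_ : _ \o _ = id); last by apply/funext => p; rewrite /= rV_consK.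
by rewrite preimage_id product_measure1E// lte_mul_pinfty// ge0_fin_numE.
Qed.

HB.instance Definition _ := Measure_isSigmaFinite.Build _ _ _
  lebesgue_rV_step lebesgue_rV_step_sigma_finite.

End step.

Fixpoint lebesgue_rV n : {sigma_finite_measure set 'rV[R]_n -> \bar R} :=
  if n is m.+1 then lebesgue_rV_step (lebesgue_rV m) else \d_(0%R : 'rV[R]_0).

End lebesgue_rV.

Section wavelets.
Context {R : realType} {d : nat}.
Implicit Types (f g phi : 'rV[R]_d -> R) (x : 'rV[R]_d).

Local Notation mu := (@lebesgue_rV R d).

Definition intvec (k : 'rV[int]_d) : 'rV[R]_d := map_mx intr k.

(* [`|x|] is the sup norm on ['rV[R]_d]; fast decay does not depend on the
   choice of the norm. *)
Definition fast_decay f :=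
  forall N : nat, exists C : R, forall x, `|f x| <= C * (1 + `|x|) ^- N.

Definition iter_partial (s : seq 'I_d) f : 'rV[R]_d -> R :=
  foldr (fun i g x => 'D_(delta_mx ord0 i) g x) f s.

Definition fast_decay_upto (r : nat) f :=
  forall s : seq 'I_d,
    ((size s < r)%N ->
       forall i x, derivable (iter_partial s f) x (delta_mx ord0 i)) /\
    ((size s <= r)%N -> fast_decay (iter_partial s f)).

Definition orthonormal_basis_L2 (I : eqType) (e : I -> 'rV[R]_d -> R) :=
  [/\ forall a, e a \in Lfun mu 2%:E,
      forall a b, \int[mu]_(x in setT) (e a x * e b x) = (a == b)%:R
    & forall f, f \in Lfun mu 2%:E -> forall eps : R, 0 < eps ->
        exists (s : seq I) (c : I -> R),
          ('N[mu]_2%:E[EFin \o (fun x => f x - \sum_(a <- s) c a * e a x)%R]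
            < eps%:E)%E].

(* [inl k] stands for phi(x - k) and [inr (j, k, i)] for
   2^(dj/2) Psi^(i)(2^j x - k). *)
Definition wavelet_system phi (Psi : 'I_(2 ^ d - 1) -> 'rV[R]_d -> R)
    (a : 'rV[int]_d + nat * 'rV[int]_d * 'I_(2 ^ d - 1)) x : R :=
  match a with
  | inl k => phi (x - intvec k)
  | inr (j, k, i) =>
      Num.sqrt (2 ^+ (d * j)) * Psi i (2 ^+ j *: x - intvec k)
  end.

Definition smooth_wavelet_basis (r : nat) phi
    (Psi : 'I_(2 ^ d - 1) -> 'rV[R]_d -> R) :=
  [/\ fast_decay_upto r phi,
      forall i, fast_decay_upto r (Psi i)
    & orthonormal_basis_L2 (wavelet_system phi Psi)].

(* Functions on (resp. subsets of) T^d = R^d / Z^d are represented by the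
   Z^d-periodic functions on (resp. subsets of) R^d. *)

(* Positive part minus negative part: meaningful for absolutely summable
   families, as is the case below by fast decay. *)
Definition sum_Zd (u : 'rV[int]_d -> R) : R :=
  fine (\esum_(l in [set: 'rV[int]_d]) (u^\+ l)%:E) -
  fine (\esum_(l in [set: 'rV[int]_d]) (u^\- l)%:E).

Definition periodized (psi : 'rV[R]_d -> R) (j : nat) (k : 'rV[int]_d) x : R :=
  sum_Zd (fun l => psi (2 ^+ j *: (x - intvec l) - intvec k)).

(* The k in Z^d such that 2^-j k lies in [0, 1[^d. *)
Definition dyadic (j : nat) := {ffun 'I_d -> 'I_(2 ^ j)}.

Definition dyadic_vec (j : nat) (k : dyadic j) : 'rV[int]_d :=
  \row_m (k m : nat)%:Z.

Definition wavelet_coefs := forall j : nat, 'I_(2 ^ d - 1) -> dyadic j -> R.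

Definition coefs_sup (c : wavelet_coefs) (j : nat) : R :=
  sup [set `|c j p.1 p.2| | p in [set: 'I_(2 ^ d - 1) * dyadic j]].

Definition wavelet_layer (Psi : 'I_(2 ^ d - 1) -> 'rV[R]_d -> R)
    (c : wavelet_coefs) (j : nat) x : R :=
  \sum_i \sum_k c j i k * periodized (Psi i) j (dyadic_vec k) x.

Definition wavelet_partial_sum (Psi : 'I_(2 ^ d - 1) -> 'rV[R]_d -> R)
    (c : wavelet_coefs) (J : nat) x : R :=
  \sum_(j < J.+1) wavelet_layer Psi c j x.

(* R^d is cut into a locally finite family of disjoint open pieces, up to a
   Lebesgue-negligible set, and the restriction of [f] to each piece extends
   continuously to the closure of the piece. *)
Definition piecewise_continuous f :=
  exists (O : nat -> set 'rV[R]_d) (g : nat -> 'rV[R]_d -> R),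
    [/\ (forall n, open (O n)) /\ trivIset setT O,
        forall x, exists2 V, nbhs x V & finite_set [set n | O n `&` V !=set0],
        mu.-negligible (~` \bigcup_n O n)
      & forall n, {within closure (O n), continuous (g n)} /\
                  {in O n, f =1 g n}].

Definition Zd_periodic (T : Type) (h : 'rV[R]_d -> T) :=
  forall x (l : 'rV[int]_d), h (x + intvec l) = h x.

Definition unit_cube : set 'rV[R]_d :=
  [set x | forall i, 0 <= x ord0 i < 1].

Definition smooth f :=
  forall s : seq 'I_d,
    continuous (iter_partial s f) /\
    forall i x, derivable (iter_partial s f) x (delta_mx ord0 i).

(* The support is closed in the compact space T^d, hence compact. *)
Definition test_function (U : set 'rV[R]_d) (theta : 'rV[R]_d -> R) :=
  [/\ smooth theta, Zd_periodic theta
    & closure [set x | theta x != 0] `<=` U].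

Definition Linfty_on (U : set 'rV[R]_d) g :=
  [/\ Zd_periodic g, measurable_fun U g
    & exists M : R, {ae mu, forall x, U x -> `|g x| <= M}].

Definition cvg_distribution (U : set 'rV[R]_d)
    (S : nat -> 'rV[R]_d -> R) g :=
  forall theta, test_function U theta ->
    \int[mu]_(x in unit_cube) (S J x * theta x) @[J --> \oo] -->
    \int[mu]_(x in unit_cube `&` U) (g x * theta x).

Definition nowhere_locally_bounded (S : nat -> 'rV[R]_d -> R) :=
  ~ exists U : set 'rV[R]_d,
      [/\ open U, U !=set0, Zd_periodic U
        & exists2 g, Linfty_on U g & cvg_distribution U S g].

End wavelets.

(* Main.v *)
(* Part (1): by fast decay, the sums over k of |psi_(j,k)(x)| are bounded
   uniformly in j and x, so |f_j| <= C omega_j and the Weierstrass test applies.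

   Part (2) uses no vanishing moment of the wavelets.  Let Psi be one of them,
   bounded away from 0, with constant sign, near some y = a / (2^q - 1) with a in
   Z^d.  As 2^q y = y modulo Z^d, at a point x0 = 2^-(r + q n) (y + m) some
   psi_(j,k) satisfies |psi_(j,k)| >= c near x0 for each large j = r modulo q, and
   r can be chosen such that the omega_j with j = r modulo q are not summable.  So
   V_j(theta) = omega_j sum_(i,k) |<psi_(j,k), theta>|, the largest value of
   <f_j, theta> over the signs of coefficients of modulus omega_j, has
   sum_j V_j(theta) > Q |theta|_1 for bumps theta near x0, whatever Q and
   the first scale of the sum.
   The signs at scale j are those attaining V_j(theta_j), where theta_j is constant
   on successive blocks of scales.  Near each x0, if some bump has divergent
   sum_j V_j(theta), blocks devoted to it make <S_J, theta> diverge; otherwise a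
   block outweighs both the earlier scales (at most C sum omega_j |theta|_1) and the
   tail, which makes lim <S_J, theta> larger than any multiple of |theta|_1. *)
Require Import Defs.
From mathcomp Require Import all_boot all_order all_algebra.
From mathcomp Require Import all_classical all_reals all_analysis.
From mathcomp Require Import measurable_realfun finmap ring lra zify.

Set Implicit Arguments.
Unset Strict Implicit.
Unset Printing Implicit Defensive.

Import Order.TTheory GRing.Theory Num.Theory.
Import numFieldNormedType.Exports.

Local Open Scope classical_set_scope.
Local Open Scope ring_scope.

(** * Sums over Z^d *)

Section lattice_sums.
Context {R : realType} {d : nat}.
Implicit Types u v a b : 'rV[int]_d -> R.

Definition abs_summable u :=
  (\esum_(l in [set: 'rV[int]_d]) (`|u l|)%:E < +oo)%E.

Definition nnsum u : R := fine (\esum_(l in [set: 'rV[int]_d]) (u l)%:E).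

Lemma abs_summable_le u v : abs_summable v -> (forall l, `|u l| <= `|v l|) ->
  abs_summable u.
Proof.
move=> sv uv; apply: le_lt_trans sv; apply: le_esum => l _.
by rewrite lee_fin.
Qed.

Lemma abs_summable_norm u : abs_summable u -> abs_summable (fun l => `|u l|).
Proof. by move=> su; apply: abs_summable_le su _ => l; rewrite normr_id. Qed.

Lemma abs_summableD u v : abs_summable u -> abs_summable v ->
  abs_summable (fun l => u l + v l).
Proof.
move=> su sv; rewrite /abs_summable.
apply: le_lt_trans (lte_add_pinfty su sv); rewrite -esumD//.
by apply: le_esum => l _; rewrite -EFinD lee_fin ler_normD.
Qed.

Lemma abs_summableN u : abs_summable u -> abs_summable (fun l => - u l).
Proof. by move=> su; apply: abs_summable_le su _ => l; rewrite normrN. Qed.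

Lemma nnsumK u : abs_summable u -> (forall l, 0 <= u l) ->
  (nnsum u)%:E = \esum_(l in [set: 'rV[int]_d]) (u l)%:E.
Proof.
move=> su u0; rewrite /nnsum fineK// ge0_fin_numE; last first.
  by apply: esum_ge0 => l _; rewrite lee_fin.
apply: le_lt_trans su; apply: le_esum => l _.
by rewrite lee_fin ler_norm.
Qed.

Lemma nnsum_ge0 u : (forall l, 0 <= u l) -> 0 <= nnsum u.
Proof.
by move=> u0; apply/fine_ge0/esum_ge0 => l _; rewrite lee_fin.
Qed.

Lemma nnsumD a b : abs_summable a -> abs_summable b ->
  (forall l, 0 <= a l) -> (forall l, 0 <= b l) ->
  nnsum (fun l => a l + b l) = nnsum a + nnsum b.
Proof.
move=> sa sb a0 b0; apply: EFin_inj; rewrite EFinD !nnsumK//.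
- by rewrite -esumD// => l _; rewrite lee_fin.
- exact: abs_summableD.
- by move=> l; rewrite addr_ge0.
Qed.

Lemma le_nnsum a b : abs_summable b -> (forall l, 0 <= a l) ->
  (forall l, a l <= b l) -> nnsum a <= nnsum b.
Proof.
move=> sb a0 ab; have b0 l : 0 <= b l := le_trans (a0 l) (ab l).
rewrite -lee_fin !nnsumK//.
  by apply: le_esum => l _; rewrite lee_fin.
by apply: abs_summable_le sb _ => l; rewrite !ger0_norm.
Qed.

(** From [u^\+ + b = u^\- + a] and the additivity of [nnsum], any splitting into nonnegative
    summable families computes [sum_Zd u], so a convenient one can replace the positive and negative
    parts. *)
Lemma sum_ZdE u a b : abs_summable a -> abs_summable b ->
  (forall l, 0 <= a l) -> (forall l, 0 <= b l) ->
  (forall l, u l = a l - b l) -> sum_Zd u = nnsum a - nnsum b.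
Proof.
move=> sa sb a0 b0 uab.
have su : abs_summable u.
  apply: (@abs_summable_le _ (fun l => a l - b l)) => [|l]; last by rewrite uab.
  exact/abs_summableD/abs_summableN.
have p0 := funrpos_ge0 u.
have n0 := funrneg_ge0 u.
have sp : abs_summable (u^\+)%R.
  apply: abs_summable_le su _ => l; rewrite ger0_norm// /funrpos.
  by rewrite ge_max ler_norm normr_ge0.
have sn : abs_summable (u^\-)%R.
  apply: abs_summable_le su _ => l; rewrite ger0_norm// /funrneg.
  by rewrite ge_max -normrN ler_norm normr_ge0.
rewrite /sum_Zd -/(nnsum (u^\+)%R) -/(nnsum (u^\-)%R).
suff : nnsum (u^\+)%R + nnsum b = nnsum (u^\-)%R + nnsum a by lra.
rewrite -!nnsumD//; congr nnsum; apply/funext => l.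
rewrite /funrpos /funrneg uab /Num.max; do ! case: ifPn; lra.
Qed.

Lemma sum_ZdB u v : abs_summable u -> abs_summable v ->
  sum_Zd (fun l => u l - v l) = sum_Zd u - sum_Zd v.
Proof.
(* With [|w| + w] and [|w|] as the two nonnegative families, no case analysis on signs is needed for
   the difference. *)
have key w : abs_summable w ->
    sum_Zd w = nnsum (fun l => `|w l| + w l) - nnsum (fun l => `|w l|) /\
    abs_summable (fun l => `|w l| + w l) /\ forall l, 0 <= `|w l| + w l.
  move=> sw; have sw' := abs_summable_norm sw.
  have w0 l : 0 <= `|w l| + w l by have := ler_norm (- w l); rewrite normrN;
    lra.
  split; last by split; [exact: abs_summableD|].
  apply: sum_ZdE => //; first exact: abs_summableD.
  by move=> l; lra.
move=> su sv; have [-> [su1 u0]] := key _ su; have [-> [sv1 v0]] := key _ sv.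
have su' := abs_summable_norm su; have sv' := abs_summable_norm sv.
rewrite (@sum_ZdE _ (fun l => (`|u l| + u l) + `|v l|)
                    (fun l => (`|v l| + v l) + `|u l|)).
- by rewrite !(@nnsumD (fun l => _ + _))//; lra.
- exact: abs_summableD.
- exact: abs_summableD.
- by move=> l; rewrite addr_ge0.
- by move=> l; rewrite addr_ge0.
- by move=> l; lra.
Qed.

Lemma ler_norm_sum_Zd u : abs_summable u ->
  `|sum_Zd u| <= nnsum (fun l => `|u l|).
Proof.
move=> su; have su' := abs_summable_norm su.
have p0 := funrpos_ge0 u.
have n0 := funrneg_ge0 u.
have /(le_nnsum su' p0) P1 : forall l, (u^\+)%R l <= `|u l|.
  by move=> l; rewrite /funrpos ge_max ler_norm normr_ge0.
have /(le_nnsum su' n0) P2 : forall l, (u^\-)%R l <= `|u l|.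
  by move=> l; rewrite /funrneg ge_max -normrN ler_norm normr_ge0.
have P3 := nnsum_ge0 p0; have P4 := nnsum_ge0 n0.
rewrite /sum_Zd -/(nnsum (u^\+)%R) -/(nnsum (u^\-)%R) ler_norml; lra.
Qed.

Lemma sum_Zd_reindex u (s : 'rV[int]_d -> 'rV[int]_d) : bijective s ->
  sum_Zd (fun l => u (s l)) = sum_Zd u.
Proof.
rewrite -setTT_bijective => bs; rewrite /sum_Zd.
rewrite (@reindex_esum R _ _ _ _ _ (fun l => (u^\+ l)%:E) bs).
by rewrite (@reindex_esum R _ _ _ _ _ (fun l => (u^\- l)%:E) bs).
Qed.

Lemma nnsum_fset (X : {fset 'rV[int]_d}) u : (forall l, 0 <= u l) ->
  nnsum (fun l => if l \in X then u l else 0) = \sum_(l <- X) u l.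
Proof.
move=> u0; rewrite /nnsum (eq_esum (b := fun l =>
  if l \in [set` X] then (u l)%:E else 0%E)); last first.
  by move=> l _; rewrite mem_setE; case: ifPn.
rewrite -esum_mkcond esum_fset//; last by move=> i _; rewrite lee_fin.
rewrite fsbig_finite//= set_fsetK sumEFin//.
Qed.

Lemma abs_summable_fset (X : {fset 'rV[int]_d}) u :
  abs_summable (fun l => if l \in X then u l else 0).
Proof.
rewrite /abs_summable (eq_esum (b := fun l =>
  if l \in [set` X] then `|u l|%:E else 0%E)); last first.
  by move=> l _; rewrite mem_setE; case: ifPn; rewrite ?normr0.
rewrite -esum_mkcond esum_fset// fsbig_finite//= sumEFin; exact: ltry.
Qed.

Lemma sum_Zd_fset (X : {fset 'rV[int]_d}) u :
  sum_Zd (fun l => if l \in X then u l else 0) = \sum_(l <- X) u l.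
Proof.
have w0 l : 0 <= `|u l| + u l by have := ler_norm (- u l); rewrite normrN; lra.
rewrite (@sum_ZdE _ (fun l => if l \in X then `|u l| + u l else 0)
  (fun l => if l \in X then `|u l| else 0)).
- rewrite !nnsum_fset// -sumrB; apply: eq_bigr => l _; lra.
- exact: abs_summable_fset.
- exact: abs_summable_fset.
- by move=> l; case: ifPn.
- by move=> l; case: ifPn.
- by move=> l; case: ifPn => _; lra.
Qed.

(** Subtracting the finite sum leaves a family that is zero on [X] and dominated by [h] outside. The
    bound involves [h] only, hence is uniform over all families dominated by [h]. *)
Lemma sum_Zd_tail (X : {fset 'rV[int]_d}) u h : abs_summable h ->
  (forall l, `|u l| <= h l) ->
  `|sum_Zd u - \sum_(l <- X) u l| <= nnsum h - \sum_(l <- X) h l.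
Proof.
move=> sh uh; have h0 l : 0 <= h l := le_trans (normr_ge0 _) (uh l).
have su : abs_summable u.
  by apply: abs_summable_le sh _ => l; rewrite (ger0_norm (h0 l)).
rewrite -sum_Zd_fset -sum_ZdB//; last exact: abs_summable_fset.
apply: le_trans (ler_norm_sum_Zd _) _.
  by apply: abs_summableD => //; apply/abs_summableN/abs_summable_fset.
rewrite lerBrDr -(nnsum_fset X h0) -nnsumD//.
- apply: le_nnsum => // l.
    by rewrite addr_ge0//; case: ifPn.
  by case: ifPn => _; rewrite ?subrr ?normr0 ?subr0 ?addr0 ?add0r.
- apply: abs_summable_le sh _ => l; rewrite normr_id (ger0_norm (h0 l)).
  by case: ifPn => _; rewrite ?subrr ?normr0 ?subr0.
- exact: abs_summable_fset.
- by move=> l; case: ifPn.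
Qed.

Lemma nnsum_approx h (e : R) : abs_summable h -> (forall l, 0 <= h l) ->
  0 < e -> exists X : {fset 'rV[int]_d}, nnsum h - \sum_(l <- X) h l < e.
Proof.
move=> sh h0 e0.
have : ((nnsum h - e)%:E < \esum_(l in [set: 'rV[int]_d]) (h l)%:E)%E.
  by rewrite -nnsumK// lte_fin; lra.
move=> /ereal_sup_gt[_ [A [fA _] <-]].
rewrite fsbig_finite//= sumEFin lte_fin => H; exists (fset_set A); lra.
Qed.

Lemma sum_fset_le_nnsum h (X : {fset 'rV[int]_d}) : abs_summable h ->
  (forall l, 0 <= h l) -> \sum_(l <- X) h l <= nnsum h.
Proof.
move=> sh h0; rewrite -nnsum_fset//; apply: le_nnsum => // l; case: ifPn => //.
Qed.

Lemma abs_summableP u (A : R) : 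
  (forall X : {fset 'rV[int]_d}, \sum_(l <- X) `|u l| <= A) ->
  abs_summable u /\ nnsum (fun l => `|u l|) <= A.
Proof.
move=> H.
have E : (\esum_(l in [set: 'rV[int]_d]) `|u l|%:E <= A%:E)%E.
  apply: ge_ereal_sup => _ [X [fX _] <-].
  by rewrite fsbig_finite//= sumEFin lee_fin.
have su : abs_summable u by apply: le_lt_trans E _; exact: ltry.
split=> //; rewrite -lee_fin nnsumK//; exact: abs_summable_norm.
Qed.

Lemma sum_uniq_le_nnsum h (s : seq 'rV[int]_d) : uniq s -> abs_summable h ->
  (forall l, 0 <= h l) -> \sum_(l <- s) h l <= nnsum h.
Proof.
move=> us sh h0; rewrite (perm_big (seq_fset tt s)).
  exact: sum_fset_le_nnsum.
by apply: uniq_perm => // l; rewrite seq_fsetE.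
Qed.

Lemma abs_summable_inj u (s : 'rV[int]_d -> 'rV[int]_d) : injective s ->
  abs_summable u ->
  abs_summable (fun l => u (s l)) /\
  nnsum (fun l => `|u (s l)|) <= nnsum (fun l => `|u l|).
Proof.
move=> sinj su; apply: abs_summableP => X.
rewrite -(big_map s xpredT (fun l => `|u l|)); apply: sum_uniq_le_nnsum => //.
  by rewrite map_inj_uniq// fset_uniq.
exact: abs_summable_norm.
Qed.

Lemma abs_summableZ u (c : R) : 0 <= c -> abs_summable u ->
  abs_summable (fun l => c * u l) /\
  nnsum (fun l => `|c * u l|) <= c * nnsum (fun l => `|u l|).
Proof.
move=> c0 su; apply: abs_summableP => X.
rewrite (eq_bigr (fun l => c * `|u l|)) => [|l _]; last first.
  by rewrite normrM ger0_norm.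
rewrite -mulr_sumr ler_wpM2l//.
exact: sum_fset_le_nnsum (abs_summable_norm su) _.
Qed.

End lattice_sums.

(** * A summable weight on the lattice *)

Section lattice_weight.
Context {R : realType} {d : nat}.

Lemma ler_coord_norm n (x : 'rV[R]_n) i : `|x ord0 i| <= `|x|.
Proof.
rewrite [leRHS]/Num.Def.normr /= mx_normrE; apply/bigmax_geP; right => /=.
by exists (ord0, i).
Qed.

Lemma norm_rV_le n (x : 'rV[R]_n) e : 0 <= e ->
  (forall i, `|x ord0 i| <= e) -> `|x| <= e.
Proof.
move=> e0 H; rewrite [leLHS]/Num.Def.normr /= mx_normrE; apply/bigmax_leP;
  split=> //=.
by move=> [i j] _ /=; rewrite ord1.
Qed.

Lemma sum_inv_sqr_le n : \sum_(k < n) (1 + k%:R) ^- 2 <= 2 :> R.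
Proof.
(* The strengthened bound makes the induction telescope, since [(1 + n) ^- 2 <= 2 / (1 + n) - 2 / (2
   + n)]. *)
suff : \sum_(k < n) (1 + k%:R) ^- 2 <= 2 - 2 / (1 + n%:R) :> R.
  by move/le_trans; apply; rewrite gerBl divr_ge0// addr_ge0.
elim: n => [|n ih]; first by rewrite big_ord0 addr0 divr1 subrr.
rewrite big_ord_recr/= (le_trans (lerD ih (lexx _)))// -addn1 natrD.
have n0 : (0 : R) <= n%:R by [].
set t : R := n%:R in n0 *.
rewrite -subr_ge0.
rewrite (_ : _ - _ = t / ((1 + t) ^+ 2 * (2 + t))); last first.
  by field; rewrite !lt0r_neq0; lra.
by rewrite divr_ge0// mulr_ge0 ?sqr_ge0//; lra.
Qed.

(** The exponent 2d affords one inverse square per coordinate, so that a product of one-dimensional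
    series dominates the sum over Z^d. *)
Definition lattice_weight (m : 'rV[int]_d) : R :=
  (1 + `|intvec m : 'rV[R]_d|) ^- (d + d).

Lemma lattice_weight_ge0 m : 0 <= lattice_weight m.
Proof. by rewrite invr_ge0 exprn_ge0// addr_ge0. Qed.

Lemma lattice_weight_prod m :
  lattice_weight m <= \prod_(i < d) (1 + `|m ord0 i|%N%:R) ^- 2.
Proof.
rewrite /lattice_weight addnn -muln2 mulnC exprM -exprVn.
rewrite -[X in _ ^+ X]card_ord -prodr_const; apply: ler_prod => i _.
rewrite invr_ge0 sqr_ge0/= lef_pV2 ?posrE ?exprn_gt0 ?ltr_pwDl//.
rewrite lerXn2r ?nnegrE ?addr_ge0// lerD2l.
apply: le_trans (ler_coord_norm _ i); rewrite mxE.
by rewrite -intr_norm natr_absz.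
Qed.

(** The map [e] encodes the points of a finite set by the signs and absolute values of their
    coordinates. The sum of products over all codes factors into d sums, each at most 4: two signs,
    and inverse squares adding up to at most 2. *)
Lemma abs_summable_lattice_weight : abs_summable lattice_weight.
Proof.
apply: (@abs_summableP _ _ _ (4 ^+ d) _).1 => X.
pose L := (\max_(m <- X) \max_(i < d) `|m ord0 i|)%N.
have XL m i : m \in X -> (`|m ord0 i| < L.+1)%N.
  move=> mX; rewrite ltnS /L (big_rem m)//= (leq_trans _ (leq_maxl _ _))//.
  exact: (@leq_bigmax _ (fun i => `|m ord0 i|%N) i).
pose e (m : 'rV[int]_d) : {ffun 'I_d -> bool * 'I_L.+1} :=
  [ffun i => (0 <= m ord0 i, inord `|m ord0 i|%N)].
pose w (p : bool * 'I_L.+1) : R := (1 + p.2%:R) ^- 2.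
have w0 p : 0 <= w p by rewrite invr_ge0 sqr_ge0.
have einj : {in X &, injective e}.
  move=> m m' mX m'X /ffunP H; apply/rowP => i.
  have := H i; rewrite !ffunE => -[] s /(congr1 (@nat_of_ord _)).
  rewrite !inordK ?XL//; move: s.
  by case: (m ord0 i) => a; case: (m' ord0 i) => b //= _ [->].
have -> : \sum_(m <- X) `|lattice_weight m| = \sum_(m <- X) lattice_weight m.
  by apply: eq_bigr => m _; rewrite ger0_norm// lattice_weight_ge0.
apply: (@le_trans _ _ (\sum_(f : {ffun 'I_d -> bool * 'I_L.+1})
   \prod_(i < d) w (f i))); last first.
  rewrite -(bigA_distr_bigA (fun _ => w)) prodr_const card_ord.
  rewrite lerXn2r ?nnegrE ?sumr_ge0//.
  rewrite (eq_bigr (fun p => (fun b k => w (b, k)) p.1 p.2))/=; last by case.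
  rewrite -(pair_bigA _ (fun b k => w (b, k)))/= big_bool.
  have := sum_inv_sqr_le L.+1; rewrite /w/=; lra.
rewrite [leRHS](bigID (fun f => f \in map e X))/=.
rewrite -[leLHS]addr0 lerD//; last by apply: sumr_ge0 => f _; exact: prodr_ge0.
rewrite -big_uniq/=; last by rewrite map_inj_in_uniq//; exact: fset_uniq.
rewrite big_map big_seq [leRHS]big_seq; apply: ler_sum => m mX.
apply: le_trans (lattice_weight_prod m) _; apply: ler_prod => i _.
rewrite invr_ge0 sqr_ge0/= /w ffunE/= inordK ?XL//.
Qed.

(** For [|y| <= r], the inequality [1 + |m| <= (1 + r) (1 + |y - m|)] transfers the decay from
    [y - m] to [m], uniformly in [y]. *)
Lemma fast_decay_lattice (f : 'rV[R]_d -> R) N : fast_decay f ->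
  exists2 C : R, 0 < C & forall (r : R) y m, 0 <= r -> `|y| <= r ->
    `|f (y - intvec m)| <= C * (1 + r) ^+ N * (1 + `|intvec m : 'rV[R]_d|) ^- N.
Proof.
move=> /(_ N)[C0 HC]; exists (Num.max 1 C0); first by rewrite lt_max ltr01.
move=> r y m r0 yr; apply: le_trans (HC _) _.
rewrite -mulrA; apply: ler_pM => //.
- have := le_trans (normr_ge0 _) (HC 0).
  by rewrite normr0 addr0 expr1n invr1 mulr1.
- by rewrite le_max lexx orbT.
rewrite -exprVn -exprVn -exprMn lerXn2r ?nnegrE ?invr_ge0 ?mulr_ge0 ?addr_ge0//.
rewrite ler_pdivlMr ?ltr_pwDl// mulrC ler_pdivrMr ?ltr_pwDl//.
have := ler_distD y (intvec m) 0; rewrite !subr0 distrC => H.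
rewrite (le_trans (lerD (lexx _) H))// mulrDr mulr1 mulrDl mul1r.
have : 0 <= r * `|y - intvec m| by rewrite mulr_ge0.
lra.
Qed.
End lattice_weight.

(** * Periodized wavelets *)

Section periodization.
Context {R : realType} {d : nat}.
Implicit Types (psi : 'rV[R]_d -> R) (k l m p : 'rV[int]_d) (x y : 'rV[R]_d).

Lemma intvecD k l : intvec (k + l) = intvec k + intvec l :> 'rV[R]_d.
Proof. by rewrite /intvec map_mxD. Qed.

Lemma intvecB k l : intvec (k - l) = intvec k - intvec l :> 'rV[R]_d.
Proof. by rewrite /intvec map_mxB. Qed.

Lemma intvec0 : intvec 0 = 0 :> 'rV[R]_d.
Proof. by rewrite /intvec map_mx0. Qed.

Lemma intvecZ (n : nat) l : intvec (n%:Z *: l) = n%:R *: intvec l :> 'rV[R]_d.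
Proof. by apply/rowP => i; rewrite !mxE intrM. Qed.

(** A periodized wavelet thus becomes a sum, over the coset [2^j Z^d + k] of the lattice, of
    translates of [psi] taken at the single point [2^j x]. *)
Lemma dilation_intvec j l k x :
  2 ^+ j *: (x - intvec l) - intvec k
  = 2 ^+ j *: x - intvec ((2 ^ j)%N%:Z *: l + k).
Proof. by rewrite intvecD intvecZ natrX scalerBr opprD addrA. Qed.

Lemma dilation_inj j k : injective (fun l : 'rV[int]_d => (2 ^ j)%N%:Z *: l + k).
Proof.
move=> l l' /addIr H; apply/rowP => i.
have := congr1 (fun v : 'rV[int]_d => v ord0 i) H; rewrite !mxE.
by apply: mulfI; rewrite eqz_nat expn_eq0.
Qed.

Definition floorvec x : 'rV[int]_d := map_mx Num.floor x.

Lemma floorvec_itv x i : 0 <= (x - intvec (floorvec x)) ord0 i < 1.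
Proof.
rewrite !mxE subr_ge0 floor_le/=.
have := floorD1_gt (x ord0 i); rewrite intrD; lra.
Qed.

Lemma norm_floorvec x : `|x - intvec (floorvec x)| <= 1.
Proof.
apply: norm_rV_le => // i; have := floorvec_itv x i.
by move=> /andP[H0 /ltW H1]; rewrite ger0_norm.
Qed.

Section fast_decay.
Variables (psi : 'rV[R]_d -> R) (fd : fast_decay psi).

(** The sum is periodic in [y]: translating by the integer part [q] reduces to [|y| <= 1], where
    decay of order 2d compares the terms with the lattice weight. *)
Lemma lattice_sum_bounded : exists C : R, forall y,
  abs_summable (fun m => psi (y - intvec m)) /\
  nnsum (fun m => `|psi (y - intvec m)|) <= C.
Proof.
have [C C0 HC] := fast_decay_lattice (d + d) fd.
pose K := C * (1 + 1) ^+ (d + d);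
  have K0 : 0 <= K by rewrite mulr_ge0 ?exprn_ge0// ltW.
exists (K * nnsum (fun l => `|@lattice_weight R d l|)) => y.
pose u m : R := K * lattice_weight m.
pose q := floorvec y.
have [su uK] := abs_summableZ K0 (@abs_summable_lattice_weight R d).
have qi : injective (fun m => m - q) by exact: addIr.
have [su' uK'] := abs_summable_inj qi su.
have uH m : `|psi (y - intvec m)| <= `|u (m - q)|.
  rewrite [leRHS]ger0_norm; last by rewrite mulr_ge0// lattice_weight_ge0.
  apply: le_trans (HC 1 (y - intvec q) (m - q) ler01 (norm_floorvec _)).
  by rewrite intvecB opprB addrA subrK.
have sp := abs_summable_le su' uH; split=> //.
by apply: le_trans (le_trans uK' uK); apply: le_nnsum => //;
  exact: abs_summable_norm.
Qed.

Lemma periodized_summable j k x :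
  abs_summable (fun l => psi (2 ^+ j *: (x - intvec l) - intvec k)).
Proof.
have [C /(_ (2 ^+ j *: x))[sp _]] := lattice_sum_bounded.
have [{}sp _] := abs_summable_inj (@dilation_inj j k) sp.
by apply: (abs_summable_le sp) => l; rewrite dilation_intvec.
Qed.

(** Coordinatewise Euclidean division: reduction modulo [2 ^ j] recovers [k], and [l] follows by
    cancellation. *)
Lemma dyadic_split_inj j (k k' : @dyadic d j) l l' :
  (2 ^ j)%N%:Z *: l + dyadic_vec k = (2 ^ j)%N%:Z *: l' + dyadic_vec k' ->
  l = l' /\ k = k'.
Proof.
move=> H.
have E i : l ord0 i = l' ord0 i /\ k i = k' i.
  have := congr1 (fun v : 'rV[int]_d => v ord0 i) H; rewrite !mxE => E.
  have /eqP := congr1 (fun z => (z %% (2 ^ j)%N%:Z)%Z) E.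
  rewrite ![(_ * l _ _)%R]mulrC ![(_ * l' _ _)%R]mulrC !modzMDl.
  rewrite !modz_nat !modn_small// => /eqP [kk']; split; last exact: val_inj.
  move: E; rewrite kk' => /addIr; apply: mulfI.
  by rewrite eqz_nat expn_eq0.
by split; [apply/rowP => i|apply/ffunP => i]; have [] := E i.
Qed.

(** The points [2^j l + k] are pairwise distinct, so the double sum over [k] and [l] is part of one
    lattice sum at [2^j x], whose bound depends neither on [j] nor on [x]. *)
Lemma sum_periodized_bounded : exists C : R, forall j x,
  \sum_(k : @dyadic d j) `|periodized psi j (dyadic_vec k) x| <= C.
Proof.
have [C HC] := lattice_sum_bounded; exists C => j x.
have [sp spC] := HC (2 ^+ j *: x); apply: le_trans spC.
pose v k l := `|psi (2 ^+ j *: (x - intvec l) - intvec k)|.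
have sv k : abs_summable (v k) := abs_summable_norm (periodized_summable j k x).
have v0 k l : 0 <= v k l by exact: normr_ge0.
apply: (@le_trans _ _ (\sum_(k : @dyadic d j) nnsum (v (dyadic_vec k)))).
  by apply: ler_sum => k _; apply: ler_norm_sum_Zd; exact: periodized_summable.
rewrite -lee_fin -sumEFin.
under eq_bigr do rewrite nnsumK//.
rewrite -esum_sum; last by move=> *; rewrite lee_fin v0.
apply: ge_ereal_sup => _ [A [fA _] <-]; rewrite fsbig_finite//=.
under eq_bigr do rewrite sumEFin.
rewrite sumEFin lee_fin.
pose e (q : 'rV[int]_d * @dyadic d j) := (2 ^ j)%N%:Z *: q.1 + dyadic_vec q.2.
rewrite (eq_bigr (fun l => \sum_(k : @dyadic d j)
  `|psi (2 ^+ j *: x - intvec (e (l, k)))|)); last first.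
  by move=> l _; apply: eq_bigr => k _; rewrite /v dilation_intvec.
rewrite -(big_allpairs (F := fun q => `|psi (2 ^+ j *: x - intvec (e q))|)).
set s := (X in \sum_(q <- X) _).
have us : uniq (map e s).
  rewrite map_inj_uniq; last first.
    by move=> [l k] [l' k']; rewrite /e/= => /dyadic_split_inj[-> ->].
  by apply: allpairs_uniq => //;
    [exact: fset_uniq|exact: index_enum_uniq|move=> [? ?] [? ?]].
rewrite -(big_map e xpredT (fun m => `|psi (2 ^+ j *: x - intvec m)|)).
by apply: sum_uniq_le_nnsum => //; exact: abs_summable_norm.
Qed.

Lemma periodized_periodic j k : Zd_periodic (periodized psi j k).
Proof.
move=> x p; rewrite /periodized.
rewrite -[RHS](@sum_Zd_reindex _ _ _ (fun l => l - p)); last first.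
  by exists (fun l => l + p) => l; rewrite ?subrK ?addrK.
by congr sum_Zd; apply/funext => l;
  rewrite intvecB opprB addrA [x + _ - _]addrAC.
Qed.

(** On the ball of radius [r], one multiple of the lattice weight along the coset dominates the
    terms for every [x], so a single finite set serves them all. *)
Lemma periodized_approx j k (r e : R) : 0 <= r -> 0 < e ->
  exists X : {fset 'rV[int]_d}, forall x, `|x| <= r ->
  `|periodized psi j k x -
    \sum_(l <- X) psi (2 ^+ j *: (x - intvec l) - intvec k)| < e.
Proof.
move=> r0 e0; have [C C0 HC] := fast_decay_lattice (d + d) fd.
pose K := C * (1 + 2 ^+ j * r) ^+ (d + d).
have K0 : 0 <= K by rewrite mulr_ge0 ?exprn_ge0 ?addr_ge0 ?mulr_ge0 ?exprn_ge0// ltW.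
have [su _] := abs_summableZ K0 (@abs_summable_lattice_weight R d).
have [{}su _] := abs_summable_inj (@dilation_inj j k) su.
have h0 l : 0 <= K * lattice_weight ((2 ^ j)%N%:Z *: l + k).
  by rewrite mulr_ge0// lattice_weight_ge0.
have [X HX] := nnsum_approx su h0 e0.
exists X => x xr; apply: le_lt_trans HX; apply: sum_Zd_tail => // l.
rewrite dilation_intvec; apply: HC.
  by rewrite mulr_ge0// exprn_ge0.
by rewrite normrZ ger0_norm ?exprn_ge0// ler_wpM2l// exprn_ge0.
Qed.

(** The terms with [l != 0] are translated by at least [2^j]. Decay of order 2d + 1 spends 2d powers
    on summability, and the remaining one gives a total of at most [K A / 2^j]. *)
Lemma periodized_main_term (r e : R) : 0 <= r -> 0 < e ->
  exists j0, forall j y, (j0 <= j)%N -> `|y| <= r ->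
  `|sum_Zd (fun l => psi (y - intvec ((2 ^ j)%N%:Z *: l))) - psi y| <= e.
Proof.
move=> r0 e0; have [C C0 HC] := fast_decay_lattice (d + d).+1 fd.
pose K := C * (1 + r) ^+ (d + d).+1.
have K0 : 0 < K by rewrite mulr_gt0 ?exprn_gt0 ?ltr_pwDl.
pose A := nnsum (fun l => `|@lattice_weight R d l|).
have A0 : 0 <= A by exact: nnsum_ge0.
have KA0 : 0 <= K * A / e := divr_ge0 (mulr_ge0 (ltW K0) A0) (ltW e0).
pose j0 := Num.bound (K * A / e).
exists j0 => j y j0j yr.
have Kj : K * A / 2 ^+ j <= e.
  rewrite ler_pdivrMr ?exprn_gt0// [e * _]mulrC -ler_pdivrMr//.
  apply: (le_trans (ltW (archi_boundP KA0))).
  rewrite -natrX ler_nat; apply: leq_trans j0j _; exact/ltnW/ltn_expl.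
have K2 : 0 <= K / 2 ^+ j by rewrite divr_ge0 ?exprn_ge0// ltW.
have [su uK] := abs_summableZ K2 (@abs_summable_lattice_weight R d).
pose X : {fset 'rV[int]_d} := [fset 0]%fset.
pose u l : R := psi (y - intvec ((2 ^ j)%N%:Z *: l)).
have ub l : l \notin X -> `|u l| <= `|K / 2 ^+ j * lattice_weight l|.
  rewrite inE => l0; rewrite [leRHS]ger0_norm; last first.
    by rewrite mulr_ge0// lattice_weight_ge0.
  apply: (le_trans (HC r _ _ r0 yr));
    rewrite -[leRHS]mulrA -/K ler_wpM2l ?(ltW K0)//.
  have l1 : 1 <= `|intvec l : 'rV[R]_d|.
    have [i li] : exists i, l ord0 i != 0.
      apply/existsP; apply: contraNT l0; rewrite negb_exists => /forallP l0.
      by apply/eqP/rowP => i; rewrite mxE; apply/eqP; have := l0 i;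
        rewrite negbK.
    apply: le_trans (ler_coord_norm _ i); rewrite mxE -intr_norm ler1z; lia.
  have j1 : 1 <= 2 ^+ j :> R by rewrite exprn_ege1// ler1n.
  rewrite intvecZ normrZ natrX ger0_norm ?exprn_ge0// /lattice_weight.
  set a := 2 ^+ j in j1 *; set b := `|_| in l1 *.
  have b0 : 0 <= b := le_trans ler01 l1.
  have ab1 : 1 + b <= 1 + a * b by nra.
  (* The quantity [1 + a b] is bounded below by [a] in the extra power and by [1 + b] in the 2d
     others. *)
  rewrite exprSr invfM mulrC; apply: ler_pM.
  - by rewrite invr_ge0; lra.
  - by rewrite invr_ge0 exprn_ge0//; lra.
  - by rewrite lef_pV2 ?posrE; nra.
  by rewrite lef_pV2 ?posrE ?exprn_gt0 ?lerXn2r ?nnegrE//; lra.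
have uE : psi y = \sum_(l <- X) u l.
  by rewrite big_seq_fset1 /u scaler0 intvec0 subr0.
pose v l := if l \in X then 0 else u l.
have sv : abs_summable v.
  by apply: abs_summable_le su _ => l; rewrite /v; case: ifPn => [|/ub//];
    rewrite normr0.
have -> : sum_Zd (fun l => psi (y - intvec ((2 ^ j)%N%:Z *: l))) - psi y = sum_Zd v.
  rewrite uE -sum_Zd_fset -sum_ZdB; last exact: abs_summable_fset.
    by congr sum_Zd; apply/funext => l; rewrite /v; case: ifPn => _;
      rewrite ?subrr ?subr0.
  apply: (abs_summable_le (abs_summableD sv (abs_summable_fset X u))) => l.
  by rewrite /v; case: ifPn => _; rewrite ?add0r ?addr0.
apply: le_trans (ler_norm_sum_Zd sv) _; apply: le_trans Kj.
rewrite mulrAC; apply: le_trans uK; apply: le_nnsum => // [|l].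
  exact: abs_summable_norm.
by rewrite /v; case: ifPn => [|/ub//]; rewrite normr0.
Qed.

End fast_decay.
End periodization.

(** * Continuity and measurability of periodized wavelets *)

Section regularity.
Context {R : realType} {d : nat}.
Implicit Types (psi : 'rV[R]_d -> R) (k l m : 'rV[int]_d) (x y : 'rV[R]_d).

Lemma continuous_sum_seq n (x : 'rV[R]_n) (I : Type) (s : seq I)
    (h : I -> 'rV[R]_n -> R) : (forall i, {for x, continuous (h i)}) ->
  {for x, continuous (fun z : 'rV[R]_n => \sum_(i <- s) h i z)}.
Proof.
move=> hc; elim: s => [|i s ih].
  rewrite (_ : (fun z => \sum_(i <- [::]) h i z) = fun=> 0);
    first exact: (@cvg_cst _ _ _ (nbhs x)).
  by apply/funext => z; rewrite big_nil.
rewrite (_ : (fun z => \sum_(i <- i :: s) h i z) =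
  h i + (fun z : 'rV[R]_n => \sum_(i <- s) h i z)).
  exact: continuousD.
by apply/funext => z; rewrite big_cons.
Qed.

Lemma continuous_rVP n (f : 'rV[R]_n -> R) (x : 'rV[R]_n) :
  {for x, continuous f} <->
  forall e, 0 < e -> \forall y \near x, `|f x - f y| < e.
Proof. exact: (@cvgrPdist_lt _ _ _ (nbhs x)). Qed.

Lemma continuous_dilation j l k :
  continuous (fun x : 'rV[R]_d => 2 ^+ j *: (x - intvec l) - intvec k).
Proof.
move=> x; apply: (@cvgB R 'rV[R]_d 'rV[R]_d (nbhs x) _
  (fun y => 2 ^+ j *: (y - intvec l)) (fun=> intvec k)); last exact: cvg_cst.
apply: (@cvgZl_tmp R 'rV[R]_d 'rV[R]_d (nbhs x) _ _ (fun y => y - intvec l)).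
apply: (@cvgB R 'rV[R]_d 'rV[R]_d (nbhs x) _ id (fun=> intvec l)).
  exact: cvg_id.
exact: cvg_cst.
Qed.

(** The finite sums of [periodized_approx] are continuous and approximate uniformly on the ball of
    radius [|x| + 1], which contains a neighbourhood of [x]. *)
Lemma periodized_continuous psi j k : fast_decay psi -> continuous psi ->
  continuous (periodized psi j k).
Proof.
move=> fd cpsi x; apply/continuous_rVP => e e0.
have e3 : 0 < e / 3 by rewrite divr_gt0.
have r0 : 0 <= `|x| + 1 by rewrite addr_ge0.
have [X HX] := periodized_approx fd j k r0 e3.
pose S y := \sum_(l <- X) psi (2 ^+ j *: (y - intvec l) - intvec k).
have : {for x, continuous S}.
  apply: continuous_sum_seq => l; apply: (@continuous_comp _ _ _ _ psi).
    exact: continuous_dilation.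
  exact: cpsi.
move=> /continuous_rVP /(_ _ e3) H1.
have H2 : \forall y \near x, `|x - y| < 1.
  by have /(@cvgrPdist_lt _ _ _ (nbhs x)) := @cvg_id _ (nbhs x); apply.
near=> y.
have y1 : `|x - y| < 1 by near: y.
have S1 : `|S x - S y| < e / 3 by near: y.
have yr : `|y| <= `|x| + 1.
  by have := ler_distD x y 0; rewrite !subr0 distrC; move: y1; lra.
have xr : `|x| <= `|x| + 1 by lra.
have := HX _ yr; have := HX _ xr; rewrite -/(S x) -/(S y).
move: S1; rewrite !ltr_norml; lra.
Unshelve. all: by end_near. Qed.

Lemma measurable_dilation j l k :
  measurable_fun setT (fun x : 'rV[R]_d => 2 ^+ j *: (x - intvec l) - intvec k).
Proof.
apply: measurable_fun_rVP => i.
rewrite (_ : _ \o _ = fun x =>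
  2 ^+ j * (rV_coord i x - (l ord0 i)%:~R) - (k ord0 i)%:~R).
  apply: measurable_funB => //; apply: measurable_funM => //.
  by apply: measurable_funB => //; exact: measurable_rV_coord.
by apply/funext => x; rewrite /rV_coord/= !mxE.
Qed.

Lemma measurable_box n (A : 'I_n -> set (measurableTypeR R)) :
  (forall i, measurable (A i)) ->
  measurable [set z : 'rV[R]_n | forall i, A i (z ord0 i)].
Proof.
move=> mA; rewrite (_ : mkset _ =
    \bigcap_(i in [set: 'I_n]) (rV_coord i @^-1` A i)).
  apply: fin_bigcap_measurable => [|i _]; first exact: finite_finset.
  by rewrite -[X in measurable X]setTI; exact: measurable_rV_coord.
by apply/seteqP; split => z H i; have := H i; rewrite /=; auto.
Qed.

Lemma measurable_unit_cube : measurable (@unit_cube R d).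
Proof.
apply: (@measurable_box _ (fun=> `[0, 1[%classic)) => i.
exact: measurable_itv.
Qed.

Lemma norm_unit_cube x : unit_cube x -> `|x| <= 1.
Proof.
move=> xc; apply: norm_rV_le => // i; have /andP[x0 /ltW x1] := xc i.
by rewrite ger0_norm.
Qed.

Lemma measurable_periodized psi j k : fast_decay psi ->
  measurable_fun setT psi -> measurable_fun unit_cube (periodized psi j k).
Proof.
move=> fd mpsi.
have P n : {X : {fset 'rV[int]_d} | forall x, `|x| <= 1 ->
  `|periodized psi j k x -
    \sum_(l <- X) psi (2 ^+ j *: (x - intvec l) - intvec k)| < n.+1%:R^-1}.
  by apply: cid; exact: periodized_approx.
apply: (@measurable_fun_cvg _ _ _ _ (fun n x =>
  \sum_(l <- sval (P n)) psi (2 ^+ j *: (x - intvec l) - intvec k))).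
  move=> n; apply: measurable_sum => l; apply: measurable_funTS.
  exact: measurableT_comp (measurable_dilation _ _ _).
move=> x /norm_unit_cube x1; apply/cvgrPdist_lt => e e0.
near=> n; apply: lt_trans (svalP (P n) _ x1) _.
by near: n; exact: near_infty_natSinv_lt (PosNum e0).
Unshelve. all: by end_near. Qed.

End regularity.

(** * Normal convergence for summable coefficients *)

Section bounded_series.
Context {R : realType} {d : nat}.
Variables (phi : 'rV[R]_d -> R) (Psi : 'I_(2 ^ d - 1) -> 'rV[R]_d -> R).
Hypothesis hPsi : smooth_wavelet_basis 0 phi Psi.

Lemma wavelet_fast_decay i : fast_decay (Psi i).
Proof. by have [_ /(_ i)/(_ [::])[_ +] _] := hPsi; apply. Qed.

Lemma ler_coefs_sup (c : @wavelet_coefs R d) j i k :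
  `|c j i k| <= coefs_sup c j.
Proof.
apply: ub_le_sup; last by exists (i, k).
exists (\sum_(p : 'I_(2 ^ d - 1) * @dyadic d j) `|c j p.1 p.2|).
move=> _ [p _ <-]; rewrite (bigD1 p)//= lerDl; exact: sumr_ge0.
Qed.

Lemma coefs_sup_ge0 (c : @wavelet_coefs R d) j : 0 <= coefs_sup c j.
Proof.
have [[p]|np] := pselect (inhabited ('I_(2 ^ d - 1) * @dyadic d j)).
  exact: le_trans (normr_ge0 _) (ler_coefs_sup c p.1 p.2).
(* Without indices, which happens for d = 0, the supremum of the empty set has the default value
   0. *)
by rewrite /coefs_sup sup_out// => -[[_ [p _ _]] _]; apply: np; exists.
Qed.

Lemma wavelet_layer_bounded : exists2 C : R, 0 <= C &
  forall c j x, `|wavelet_layer Psi c j x| <= C * coefs_sup c j.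
Proof.
have P i : {C : R | forall j x,
    \sum_(k : @dyadic d j) `|periodized (Psi i) j (dyadic_vec k) x| <= C}.
  by apply: cid; apply: sum_periodized_bounded; exact: wavelet_fast_decay.
exists (\sum_i sval (P i)).
  apply: sumr_ge0 => i _; apply: le_trans (svalP (P i) 0 0); exact: sumr_ge0.
move=> c j x; rewrite mulr_suml; apply: le_trans (ler_norm_sum _ _ _) _.
apply: ler_sum => i _; apply: le_trans (ler_norm_sum _ _ _) _.
apply: (@le_trans _ _ ((\sum_(k : @dyadic d j)
    `|periodized (Psi i) j (dyadic_vec k) x|) * coefs_sup c j)).
  rewrite mulr_suml; apply: ler_sum => k _; rewrite normrM mulrC.
  by rewrite ler_wpM2l// ler_coefs_sup.
by rewrite ler_wpM2r ?coefs_sup_ge0// (svalP (P i)).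
Qed.

Lemma wavelet_layer_continuous (c : @wavelet_coefs R d) j :
  (forall i, continuous (Psi i)) -> continuous (wavelet_layer Psi c j).
Proof.
move=> cPsi x; apply: continuous_sum_seq => i.
apply: continuous_sum_seq => k.
apply: (@cvgMl_tmp _ _ (nbhs x) _ (periodized (Psi i) j (dyadic_vec k))).
exact: periodized_continuous (wavelet_fast_decay i) (cPsi i) x.
Qed.

Lemma wavelet_series_normal_cvg (c : @wavelet_coefs R d) :
  (\sum_(0 <= j <oo) (coefs_sup c j)%:E < +oo)%E ->
  [/\ (\sum_(0 <= j <oo)
         ereal_sup [set `|wavelet_layer Psi c j x|%:E | x in setT] < +oo)%E,
      forall x, cvgn (fun J => wavelet_partial_sum Psi c J x),
      exists M : R, forall x,
        `|limn (fun J => wavelet_partial_sum Psi c J x)| <= M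
    & (forall i, continuous (Psi i)) ->
      continuous (fun x => limn (fun J => wavelet_partial_sum Psi c J x))].
Proof.
move=> cfin; have [C C0 HC] := wavelet_layer_bounded.
pose w j := coefs_sup c j; have w0 j : 0 <= w j := coefs_sup_ge0 c j.
pose W n := \sum_(j < n) w j.
have W_nd : nondecreasing_seq W.
  by apply/nondecreasing_seqP => n; rewrite /W big_ord_recr/= lerDl.
have cW : cvgn W.
  apply: nondecreasing_is_cvgn => //.
  exists (fine (\sum_(0 <= j <oo) (w j)%:E)%E) => _ [n _ <-].
  rewrite -lee_fin fineK; last first.
    by rewrite ge0_fin_numE// nneseries_ge0// => *; rewrite lee_fin.
  rewrite -sumEFin -(big_mkord xpredT (fun j => (w j)%:E)).
  by apply: nneseries_lim_ge => *; rewrite lee_fin.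
have WL n : W n <= limn W := nondecreasing_cvgn_le W_nd cW n.
pose S J x := wavelet_partial_sum Psi c J x.
have dS J J' x : (J <= J')%N -> `|S J' x - S J x| <= C * (W J'.+1 - W J.+1).
  move=> JJ'; rewrite /S /wavelet_partial_sum /W.
  rewrite -!(big_mkord xpredT (fun j => wavelet_layer Psi c j x)).
  rewrite -!(big_mkord xpredT w) !(@big_cat_nat _ _ _ J.+1 0 J'.+1)//=.
  rewrite addrAC subrr add0r addrAC subrr add0r mulr_sumr.
  apply: le_trans (ler_norm_sum _ _ _) _; apply: ler_sum => j _; exact: HC.
have cS x : cvgn (S ^~ x).
  pose f j := wavelet_layer Psi c j x.
  have cf : cvgn (series f).
    apply: normed_cvg; apply: nondecreasing_is_cvgn.
      apply/nondecreasing_seqP => n.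
      rewrite /normed_series_of seriesSr lerDl; exact: normr_ge0.
    exists (C * limn W) => _ [n _ <-]; apply: le_trans (ler_wpM2l C0 (WL n)).
    rewrite /normed_series_of seriesEord/= mulr_sumr; apply: ler_sum => j _;
      exact: HC.
  have -> : S ^~ x = fun J => series f J.+1.
    by apply/funext => J; rewrite /S /wavelet_partial_sum seriesEord.
  by move: cf => /cvg_ex[l]; rewrite -cvg_shiftS => fl; apply/cvg_ex; exists l.
(* Letting [J'] tend to infinity in [dS] gives a rate of convergence uniform in [x], which yields
   both boundedness and continuity of the limit. *)
have tail J x : `|limn (S ^~ x) - S J x| <= C * (limn W - W J.+1).
  have : `|S J' x - S J x| @[J' --> \oo] --> `|limn (S ^~ x) - S J x|.
    by apply: cvg_norm; apply: cvgB; [exact: cS|exact: cvg_cst].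
  move=> H; rewrite -(cvg_lim _ H)//; apply: limr_le; first exact: cvgP H.
  exists J => // J' JJ'; apply: le_trans (dS _ _ x JJ') _.
  by rewrite ler_wpM2l// lerD2r.
have cvgWS : W J.+1 @[J --> \oo] --> limn W by rewrite cvg_shiftS.
split.
- apply: (@le_lt_trans _ _ (\sum_(0 <= j <oo) (C%:E * (w j)%:E))%E).
    apply: lee_nneseries => j _ => [_|].
      (* The value at the point 0 shows that the supremum is nonnegative, as the comparison of
         series requires. *)
      apply: le_trans (ereal_sup_ubound _) => /=; last by exists 0.
      by rewrite lee_fin.
    apply: ge_ereal_sup => _ [x _ <-]; rewrite -EFinM lee_fin; exact: HC.
  rewrite nneseriesZl//; last by move=> j _; rewrite lee_fin.
  by rewrite lte_mul_pinfty// lee_fin.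
- exact: cS.
- exists (C * limn W) => x.
  have H0 : `|S 0%N x| <= C * W 1%N.
    by rewrite /S /wavelet_partial_sum /W !big_ord1; exact: HC.
  have := tail 0%N x; have := ler_distD (S 0%N x) (limn (S ^~ x)) 0.
  by rewrite !subr0 -/(S _ x); move: H0; rewrite mulrBr; lra.
move=> cPsi x; apply/continuous_rVP => e e0.
have CW : C * (limn W - W J.+1) @[J --> \oo] --> C * (limn W - limn W).
  by apply: cvgMl_tmp; apply: cvgB => //; exact: cvg_cst.
have /cvgr_lt/(_ (e / 3)) := CW.
rewrite subrr mulr0 divr_gt0// => /(_ isT)[J _ /(_ J (leqnn J))/= HJ].
have cSJ : {for x, continuous (S J)}.
  by apply: continuous_sum_seq => j; exact: wavelet_layer_continuous.
have e3 : 0 < e / 3 by rewrite divr_gt0.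
move/continuous_rVP : cSJ => /(_ _ e3); apply: filterS => y.
have := tail J x; have := tail J y; rewrite -!/(S _ _).
by move: HJ; rewrite !ltr_norml !ler_norml -/(S ^~ x) -/(S ^~ y); lra.
Qed.

End bounded_series.

(** * Lebesgue measure on R^d *)

Section measure_rV.
Context {R : realType}.

Lemma lebesgue_rV_box n (A : 'I_n -> set (measurableTypeR R)) (a : 'I_n -> R) :
  (forall i, measurable (A i)) ->
  (forall i, lebesgue_measure (A i) = (a i)%:E) ->
  lebesgue_rV n [set x : 'rV[R]_n | forall i, A i (x ord0 i)]
  = (\prod_(i < n) a i)%:E.
Proof.
elim: n A a => [|n ih] A a mA Aa.
  by rewrite big_ord0 /= diracE mem_set// => -[].
have mB : measurable
    [set x : 'rV[R]_n | forall i, A (lift ord0 i) (x ord0 i)].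
  by apply: (@measurable_box _ _ (fun i => A (lift ord0 i))).
rewrite /= /lebesgue_rV_step /pushforward.
rewrite (_ : _ @^-1` _ = A ord0 `*`
    [set x : 'rV[R]_n | forall i, A (lift ord0 i) (x ord0 i)]).
  rewrite product_measure1E// big_ord_recl EFinM; congr (_ * _)%E.
    exact: Aa.
  by apply: (ih (fun i => A (lift ord0 i)) (fun i => a (lift ord0 i))).
apply/seteqP; split => -[t x] /=.
  move=> H; split => [|i].
    by have := H ord0; rewrite mxE unlift_none.
  by have := H (lift ord0 i); rewrite mxE liftK.
move=> [H0 H1] i; rewrite mxE.
by case: (unliftP ord0 i) => [j|] -> //; exact: H1.
Qed.

(** An open set is the union of the countably many cubes with rational centre and half-side
    [1 / (k + 1)] that it contains, and such cubes are boxes in the coordinates. *)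
Lemma measurable_open_rV n (U : set 'rV[R]_n) : open U -> measurable U.
Proof.
move=> oU.
pose B (p : 'rV[rat]_n * nat) : set 'rV[R]_n :=
  [set x | forall i, `|x ord0 i - ratr (p.1 ord0 i)| < p.2.+1%:R^-1].
have mB p : measurable (B p).
  rewrite (_ : B p = [set x : 'rV[R]_n | forall i,
      `]ratr (p.1 ord0 i) - p.2.+1%:R^-1,
        ratr (p.1 ord0 i) + p.2.+1%:R^-1[%classic (x ord0 i)]).
    apply: (@measurable_box _ _ (fun i => `]ratr (p.1 ord0 i) - p.2.+1%:R^-1,
      ratr (p.1 ord0 i) + p.2.+1%:R^-1[%classic)) => i.
    exact: measurable_itv.
  by apply/seteqP; split => x H i; have := H i; rewrite /= in_itv/= ltr_distl.
pose F p := if `[< B p `<=` U >] then B p else set0.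
rewrite (_ : U = \bigcup_p F p).
  apply: countable_bigcupT_measurable; first exact: countableP.
  by move=> p; rewrite /F; case: ifPn.
apply/seteqP; split => [x Ux|x [p _]]; last first.
  by rewrite /F; case: ifPn => // /asboolP; apply.
have /(@nbhs_ballP _ _ x)[e /= e0 xeU] := open_nbhs_nbhs (conj oU Ux).
have [k Hk] : exists k : nat, k.+1%:R^-1 < e / 2.
  have e2 : 0 < e / 2 by rewrite divr_gt0.
  have [k _ Hk] := near_infty_natSinv_lt (PosNum e2).
  by exists k; exact: (Hk k (leqnn k)).
have [e1 e1E] : exists e1 : R, e1 = k.+1%:R^-1 by exists k.+1%:R^-1.
have e10 : 0 < e1 by rewrite e1E invr_gt0.
rewrite -e1E in Hk.
have P i : {q : rat | `|x ord0 i - ratr q| < e1}.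
  apply: cid; have [|q] := @rat_in_itvoo R (x ord0 i - e1) (x ord0 i + e1);
    first lra.
  by rewrite in_itv/= => /andP[? ?]; exists q; rewrite ltr_norml; apply/andP;
    split; lra.
exists (\row_i sval (P i), k) => //.
have Bx : B (\row_i sval (P i), k) x.
  by move=> i; rewrite mxE -e1E; exact: svalP (P i).
rewrite /F ifT//; apply/asboolP => y By; apply: xeU.
rewrite -ball_normE /=; apply: (@le_lt_trans _ _ (2 * e1)); last lra.
apply: norm_rV_le => [|i]; first lra.
have := Bx i; have := By i; rewrite /= -e1E !mxE.
rewrite !ltr_norml ler_norml => /andP[? ?] /andP[? ?]; apply/andP; split; lra.
Qed.

End measure_rV.

(** * A continuity point where a wavelet does not vanish *)

Section continuity_point.
Context {R : realType} {d : nat}.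
Local Notation mu := (@lebesgue_rV R d).

Lemma lebesgue_unit_cube : mu (@unit_cube R d) = 1%E.
Proof.
rewrite (@lebesgue_rV_box _ _ (fun=> `[0, 1[%classic) (fun=> 1)).
- by rewrite big1.
- by move=> i; exact: measurable_itv.
- by move=> i; rewrite lebesgue_measure_itv/= lte01 oppr0 adde0.
Qed.

(** Every point of an open piece is a continuity point. If [psi] vanished at all of them it would
    vanish almost everywhere, against its norm 1. *)
Lemma piecewise_continuity_point (psi : 'rV[R]_d -> R) :
  measurable_fun setT psi -> piecewise_continuous psi ->
  \int[mu]_(x in setT) (psi x * psi x) = 1 ->
  exists2 x, {for x, continuous psi} & psi x != 0.
Proof.
move=> mpsi [U [g [[oU _] _ nU Ug]]] I1.
have cU n x : U n x -> {for x, continuous psi}.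
  move=> Unx; have [cg gE] := Ug n.
  have oUx : nbhs x (U n) by exact: open_nbhs_nbhs.
  have : {within U n, continuous g n}.
    by apply: continuous_subspaceW cg; exact: subset_closure.
  rewrite continuous_open_subspace// => /(_ _ (mem_set Unx)) cgx.
  apply/continuous_rVP => e e0; move/continuous_rVP : cgx => /(_ _ e0).
  apply: filterS2 oUx => y Uy.
  by rewrite (gE x (mem_set Unx)) (gE y (mem_set Uy)).
apply: contrapT => H.
have psi0 n x : U n x -> psi x = 0.
  move=> Unx; apply: contrapT => /eqP p0; apply: H; exists x => //;
    exact: cU Unx.
suff : \int[mu]_(x in setT) (psi x * psi x) = 0.
  by rewrite I1 => /eqP; rewrite oner_eq0.
rewrite /Rintegral (@ae_eq_integral _ _ _ mu _ (cst 0%E))//.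
- by rewrite integral0.
- by apply/measurable_EFinP; exact: measurable_funM.
case: nU => A [mA A0 sA]; exists A; split => //.
move=> x /= Hx; apply: sA => -[n _ Unx]; apply: Hx => _.
by rewrite (psi0 n x Unx) mulr0.
Qed.

End continuity_point.

(** * Periodic bump functions *)

Section flat_function.
Context {R : realType}.
Implicit Types (f g : R -> R) (s t : R).

(** [flat 0] is the classical smooth function that is flat at the origin; the factors [s ^- k] make
    the span of the family closed under derivation. *)
Definition flat k s : R := if 0 < s then s ^- k * expR (- s^-1) else 0.

(** The exponential of [s^-1] exceeds the term of order k + 2 of its series. A quadratic bound is
    enough for a zero derivative at the origin. *)
Lemma flat_le k s : `|flat k s| <= (k.+2)`!%:R * s ^+ 2.
Proof.
rewrite /flat; case: ifPn => s0; last by rewrite normr0 mulr_ge0// sqr_ge0.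
have si0 : 0 <= s^-1 by rewrite invr_ge0 ltW.
have := expR_ge1Dxn k.+1 si0; set F : R := _`!%:R => H.
have F0 : 0 < F by rewrite ltr0n fact_gt0.
have e0 := expR_gt0 s^-1.
rewrite ger0_norm;
  last by rewrite mulr_ge0 ?expR_ge0// invr_ge0 exprn_ge0// ltW.
rewrite expRN ler_pdivrMr//.
apply: (@le_trans _ _ (F * s ^+ 2 * (s^-1 ^+ k.+2 / F))); last first.
  rewrite ler_wpM2l//; first by rewrite mulr_ge0 ?sqr_ge0// ltW.
  by apply: le_trans H; rewrite lerDr.
have s1 : s != 0 by rewrite gt_eqF.
rewrite (_ : F * _ * _ = s ^+ 2 * s^-1 ^+ k.+2); last by field; rewrite gt_eqF.
by rewrite (exprD _ 2 k) mulrA -exprMn mulfV// expr1n mul1r exprVn.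
Qed.

Lemma is_derive_flat k s :
  is_derive s 1 (flat k) (flat k.+2 s - k%:R * flat k.+1 s).
Proof.
have [s0|s0|<-] := ltgtP 0 s.
- apply: (@near_eq_is_derive _ _ _
    (((fun t : R => t^-1) ^+ k) * (fun t => expR (- t^-1)))).
    near=> t; have t0 : 0 < t by near: t; exact: lt_nbhsr.
    by rewrite /flat t0 -exprVn !fctE.
  rewrite /flat s0; have sn0 : s != 0 by rewrite gt_eqF.
  have Dv : is_derive s 1 (fun t => t^-1) (- s ^- 2).
    apply: is_derive_eq; first exact: is_deriveV.
    by rewrite /GRing.scale/= mulr1.
  have De : is_derive s 1 (fun t => expR (- t^-1)) (expR (- s^-1) * s ^- 2).
    apply: is_derive_eq.
    by rewrite /GRing.scale/= opprK.
  have Dk := is_deriveX k Dv.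
  apply: (is_derive_eq (is_deriveM Dk De)).
  rewrite /GRing.scale !fctE/= -!exprVn; set v := s^-1.
  by case: k {Dk} => [|k]; rewrite ?exprS ?expr0/=; ring.
- apply: (@near_eq_is_derive _ _ _ (cst 0)).
    near=> t; have t0 : t < 0 by near: t; exact: lt_nbhsl.
    by rewrite /flat ltNge (ltW t0).
  by rewrite /flat ltNge (ltW s0)/= mulr0 subr0; exact: is_derive_cst.
have E j : flat j 0 = 0 by rewrite /flat ltxx.
rewrite !E mulr0 subr0; apply/is_derive1_caratheodory.
(* The slope at the origin; it tends to 0 by [flat_le]. *)
exists (fun z => flat k z / z); split.
- move=> z; rewrite E !subr0.
  have [->|z0] := eqVneq z 0; first by rewrite E mulr0.
  by rewrite divfK.
- apply/cvgrPdist_lt => e e0; rewrite invr0 mulr0.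
  set F : R := (k.+2)`!%:R.
  have F0 : 0 < F by rewrite ltr0n fact_gt0.
  near=> z; rewrite sub0r normrN normrM normfV.
  have ze : `|z| < e / F.
    near: z; have /cvgr_dist_lt := @cvg_id _ (nbhs (0 : R)).
    move=> /(_ (e / F) (divr_gt0 e0 F0)); apply: filterS => z.
    by rewrite sub0r normrN.
  have [->|z0] := eqVneq z 0; first by rewrite normr0 invr0 mulr0.
  have nz0 : 0 < `|z| by rewrite normr_gt0.
  rewrite ltr_pdivrMr//; apply: le_lt_trans (flat_le k z) _.
  rewrite -/F -(real_normK (num_real z)) expr2 mulrA ltr_pM2r// mulrC -ltr_pdivlMr//.
- by rewrite invr0 mulr0.
Unshelve. all: by end_near. Qed.

(** The cosine makes the function 1-periodic. With [w] the cosine of [2 pi rho] and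
    [0 < rho <= 1/2], it is nonzero exactly at distance less than [rho] from [t0 + Z]. *)
Definition flat_cos (t0 w : R) k t := flat k (cos ((t - t0) *+ 2 * pi) - w).

(* This algebra contains the one-dimensional bumps and is closed under
   derivation, so its elements are smooth. *)
Inductive trig_flat (t0 w : R) : (R -> R) -> Prop :=
| trig_flat_bump k : trig_flat t0 w (flat_cos t0 w k)
| trig_flat_sin : trig_flat t0 w (fun t => sin ((t - t0) *+ 2 * pi))
| trig_flat_cos : trig_flat t0 w (fun t => cos ((t - t0) *+ 2 * pi))
| trig_flat_cst c : trig_flat t0 w (cst c)
| trig_flat_add f g : trig_flat t0 w f -> trig_flat t0 w g ->
    trig_flat t0 w (f + g)
| trig_flat_mul f g : trig_flat t0 w f -> trig_flat t0 w g ->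
    trig_flat t0 w (f * g).

Lemma trig_flat_derive t0 w f : trig_flat t0 w f ->
  exists2 g, trig_flat t0 w g & forall t, is_derive t (1 : R) f (g t).
Proof.
have Du t : is_derive t (1 : R) (fun t => (t - t0) *+ 2 * pi) (pi *+ 2).
  rewrite (_ : (fun t => _) = (fun t => pi *+ 2 * (t - t0))); last first.
    by apply/funext => x; ring.
  apply: is_derive_eq.
  by rewrite /GRing.scale/=; ring.
pose c : R := pi *+ 2.
elim=> [k|||a|f1 f2 _ [g1 t1 d1] _ [g2 t2 d2]|f1 f2 t1' [g1 t1 d1] t2' [g2 t2 d2]].
- exists ((flat_cos t0 w k.+2 + cst (- k%:R) * flat_cos t0 w k.+1) *
          (cst (- c) * (fun t => sin ((t - t0) *+ 2 * pi)))).
    do ! constructor.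
  move=> t.
  have Dc : is_derive t (1 : R) (fun t => cos ((t - t0) *+ 2 * pi) - w)
      (- c * sin ((t - t0) *+ 2 * pi)).
    apply: is_derive_eq.
    by rewrite /GRing.scale/= /c; ring.
  apply: (is_derive_eq (is_derive1_comp (is_derive_flat k _) Dc)).
  by rewrite /GRing.scale/= !fctE /flat_cos/=; ring.
- exists (cst c * (fun t => cos ((t - t0) *+ 2 * pi)));
  first by do ! constructor.
  move=> t; apply: is_derive_eq.
  by rewrite /GRing.scale/= mulrC.
- exists (cst (- c) * (fun t => sin ((t - t0) *+ 2 * pi)));
  first by do ! constructor.
  move=> t; apply: is_derive_eq.
  by rewrite /GRing.scale !fctE/= /c; ring.
- by exists (cst 0); [constructor|move=> t; exact: is_derive_cst].
- by exists (g1 + g2); [constructor|move=> t; exact: is_deriveD].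
- exists (f1 * g2 + f2 * g1); first by do ! constructor.
  by move=> t; exact: is_deriveM.
Qed.

Lemma trig_flat_smooth t0 w f : trig_flat t0 w f ->
  exists F : nat -> R -> R, F 0%N = f /\
    forall n t, is_derive t (1 : R) (F n) (F n.+1 t).
Proof.
move=> tf.
pose T := {h : R -> R | trig_flat t0 w h}.
have step (h : T) : {g : T | forall t, is_derive t (1 : R) (sval h) (sval g t)}.
  apply: cid; have [g tg Dg] := trig_flat_derive (svalP h).
  by exists (exist _ g tg).
pose F n := iter n (fun h => sval (step h)) (exist _ f tf : T).
exists (fun n => sval (F n)); split=> // n t.
exact: svalP (step (F n)) t.
Qed.

End flat_function.

(** * Partial derivatives of products of one-variable functions *)

Section product_functions.
Context {R : realType} {d : nat}.
Implicit Types (x v : 'rV[R]_d) (g : 'I_d -> R -> R).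

Lemma is_derive_coord (g : R -> R) (dg : R) x i :
  is_derive (x ord0 i) (1 : R) g dg ->
  is_derive x (delta_mx ord0 i) (fun y : 'rV[R]_d => g (y ord0 i)) dg.
Proof.
have E : (fun h : R => h^-1 *: (((fun y : 'rV[R]_d => g (y ord0 i)) \o shift x)
              (h *: delta_mx ord0 i) - g (x ord0 i))) =
    (fun h : R => h^-1 *: ((g \o shift (x ord0 i)) (h *: 1) - g (x ord0 i))).
  by apply/funext => h /=; rewrite !mxE !eqxx.
move=> [dgx dgE]; split; rewrite /derivable /derive E//.
Qed.

Lemma is_derive_along_const (f : 'rV[R]_d -> R) x v :
  (forall h : R, f (h *: v + x) = f x) -> is_derive x v f 0.
Proof.
move=> fx.
have E : (fun h : R => h^-1 *: ((f \o shift x) (h *: v) - f x)) = fun=> 0.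
  by apply/funext => h /=; rewrite fx subrr scaler0.
by split; rewrite /derivable /derive E; [exact: is_cvg_cst|exact: lim_cst].
Qed.

Lemma is_derive_prod_coord g (dg : R -> R) x i :
  is_derive (x ord0 i) (1 : R) (g i) (dg (x ord0 i)) ->
  is_derive x (delta_mx ord0 i) (fun y : 'rV[R]_d => \prod_j g j (y ord0 j))
    (\prod_j (if j == i then dg else g j) (x ord0 j)).
Proof.
move=> Dg.
rewrite (_ : (fun y : 'rV[R]_d => \prod_j g j (y ord0 j)) =
  (fun y : 'rV[R]_d => g i (y ord0 i)) *
  (fun y : 'rV[R]_d => \prod_(j | j != i) g j (y ord0 j))); last first.
  by apply/funext => y; rewrite (bigD1 i).
have D2 : is_derive x (delta_mx ord0 i)
    (fun y : 'rV[R]_d => \prod_(j | j != i) g j (y ord0 j)) 0.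
  apply: is_derive_along_const => h; apply: eq_bigr => j ji.
  by rewrite !mxE eqxx (negbTE ji)/= mulr0 add0r.
apply: (is_derive_eq (is_deriveM (is_derive_coord Dg) D2)).
rewrite scaler0 add0r /GRing.scale/= mulrC [RHS](bigD1 i)//= eqxx; congr *%R.
by apply: eq_bigr => j /negbTE ->.
Qed.

Lemma continuous_prod_coord g : (forall i, continuous (g i)) ->
  continuous (fun y : 'rV[R]_d => \prod_j g j (y ord0 j)).
Proof.
move=> cg x; elim: (index_enum _) => [|i s ih].
  rewrite (_ : (fun y : 'rV[R]_d => \prod_(j <- [::]) g j (y ord0 j)) = fun=> 1).
    exact: (@cvg_cst _ _ _ (nbhs x)).
  by apply/funext => y; rewrite big_nil.
rewrite (_ : (fun y : 'rV[R]_d => \prod_(j <- i :: s) g j (y ord0 j)) =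
  (g i \o (fun y : 'rV[R]_d => y ord0 i)) *
  (fun y : 'rV[R]_d => \prod_(j <- s) g j (y ord0 j))); last first.
  by apply/funext => y; rewrite big_cons.
apply: continuousM => //; apply: continuous_comp; last exact: cg.
exact: coord_continuous.
Qed.

Lemma smooth_prod_coord (G : 'I_d -> nat -> R -> R) :
  (forall i n t, is_derive t (1 : R) (G i n) (G i n.+1 t)) ->
  smooth (fun y : 'rV[R]_d => \prod_j G j 0%N (y ord0 j)).
Proof.
move=> DG.
(* Only the number of occurrences of [j] in [s] matters: it is the order of derivation of the [j]-th
   factor. *)
have E s : iter_partial s (fun y : 'rV[R]_d => \prod_j G j 0%N (y ord0 j)) =
    fun y => \prod_j G j (count_mem j s) (y ord0 j).
  elim: s => [//|i s /= ->]; apply/funext => x.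
  have := @is_derive_prod_coord (fun j => G j (count_mem j s))
    (G i (count_mem i s).+1) x i (DG _ _ _).
  move=> [_ ->]; apply: eq_bigr => j _; rewrite [i == j]eq_sym.
  by case: eqP => [->|].
move=> s; rewrite E; split.
  apply: (@continuous_prod_coord (fun j => G j (count_mem j s))) => i t.
  have [+ _] := DG i (count_mem i s) t.
  by move=> /derivable1_diffP/differentiable_continuous.
move=> i x.
by have [] := @is_derive_prod_coord (fun j => G j (count_mem j s))
    (G i (count_mem i s).+1) x i (DG _ _ _).
Qed.

End product_functions.

(** * Support and mass of the bumps *)

Section bump.
Context {R : realType} {d : nat}.
Local Notation mu := (@lebesgue_rV R d).
Implicit Types (x y : 'rV[R]_d) (t rho : R).

Lemma cos_int (t : R) (n : int) : cos ((t + n%:~R) *+ 2 * pi) = cos (t *+ 2 * pi).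
Proof.
have nat_case (a : R) (k : nat) : cos ((a + k%:R) *+ 2 * pi) = cos (a *+ 2 * pi).
  rewrite (_ : (a + k%:R) *+ 2 * pi = a *+ 2 * pi + (pi *+ 2) *+ k); last first.
    by rewrite -[(pi *+ 2) *+ k]mulr_natl; ring.
  by rewrite (periodicn (@cosD2pi R)).
case: n => n; first exact: nat_case.
by rewrite -[LHS](nat_case _ n.+1) NegzE mulrNz -pmulrn subrK.
Qed.

Lemma cos_lt_small (t rho : R) : 0 <= t -> t < rho -> rho <= 2^-1 ->
  cos (rho *+ 2 * pi) < cos (t *+ 2 * pi).
Proof.
move=> t0 tr r2; have pi0 := pi_gt0 R.
have A (u : R) : 0 <= u -> u <= 2^-1 -> 0 <= u *+ 2 * pi <= pi.
  move=> u0 u2; rewrite -mulr_natr; apply/andP; split.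
    by rewrite !mulr_ge0// ltW.
  by rewrite -[leRHS]mul1r ler_wpM2r ?(ltW pi0)//; lra.
rewrite ltr_cos ?in_itv/= ?A//; try lra.
by rewrite ltr_pM2r// ltr_pMn2r.
Qed.

Lemma cos_ge_near_int (t rho : R) : 0 < rho -> rho <= 2^-1 ->
  cos (rho *+ 2 * pi) <= cos (t *+ 2 * pi) ->
  exists n : int, `|t - n%:~R| <= rho.
Proof.
(* This [n] is a nearest integer to [t]. If it were farther than [rho], the strict decrease of the
   cosine on [0, pi] would contradict [H]. *)
move=> r0 r2 H; pose n := Num.floor (t + 2^-1); exists n.
rewrite leNgt; apply/negP => tr; move: H; apply/negP; rewrite -ltNge.
have u2 : `|t - n%:~R| <= 2^-1.
  have := floor_le (t + 2^-1); have := floorD1_gt (t + 2^-1).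
  by rewrite -/n intrD ler_norml; lra.
rewrite -(subrK n%:~R t) cos_int.
rewrite (_ : cos (_ *+ 2 * pi) = cos (`|t - n%:~R| *+ 2 * pi)); last first.
  by have [h|h] := leP 0 (t - n%:~R);
    rewrite ?(ger0_norm h) ?(ltr0_norm h) // mulNrn mulNr cosN.
by apply: cos_lt_small => //; exact: ltW.
Qed.

Definition lattice_bump (x0 : 'rV[R]_d) rho x : R :=
  \prod_i flat_cos (x0 ord0 i) (cos (rho *+ 2 * pi)) 0 (x ord0 i).

Lemma flat0_ge0 (s : R) : 0 <= flat 0 s.
Proof. by rewrite /flat; case: ifPn => // _;
  rewrite expr0 invr1 mul1r expR_ge0. Qed.

Lemma flat0_le1 (s : R) : flat 0 s <= 1.
Proof.
rewrite /flat; case: ifPn => // s0.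
by rewrite expr0 invr1 mul1r -expR0 ler_expR oppr_le0 invr_ge0 ltW.
Qed.

Lemma flat0_neq0 (s : R) : (flat 0 s != 0) = (0 < s).
Proof.
rewrite /flat; case: ifPn => s0; last by rewrite eqxx.
by rewrite expr0 invr1 mul1r gt_eqF// expR_gt0.
Qed.

Lemma lattice_bump_ge0 x0 rho x : 0 <= lattice_bump x0 rho x.
Proof. by apply: prodr_ge0 => i _; exact: flat0_ge0. Qed.

Lemma lattice_bump_le1 x0 rho x : lattice_bump x0 rho x <= 1.
Proof. by apply: prodr_ile1 => i _; rewrite flat0_ge0 flat0_le1. Qed.

Lemma lattice_bump_smooth x0 rho : smooth (lattice_bump x0 rho).
Proof.
have P (i : 'I_d) : {F : nat -> R -> R |
    F 0%N = flat_cos (x0 ord0 i) (cos (rho *+ 2 * pi)) 0 /\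
    forall n t, is_derive t (1 : R) (F n) (F n.+1 t)}.
  apply: cid; apply: (@trig_flat_smooth _ (x0 ord0 i) (cos (rho *+ 2 * pi))).
  exact: trig_flat_bump.
rewrite (_ : lattice_bump x0 rho =
    fun y : 'rV[R]_d => \prod_j sval (P j) 0%N (y ord0 j)).
  by apply: (@smooth_prod_coord _ _ (fun j => sval (P j))) => i n t;
    exact: (svalP (P i)).2.
apply/funext => y; apply: eq_bigr => j _.
by rewrite (svalP (P j)).1.
Qed.

Lemma lattice_bump_periodic x0 rho : Zd_periodic (lattice_bump x0 rho).
Proof.
move=> x l; apply: eq_bigr => i _; rewrite !mxE /flat_cos.
by rewrite addrAC cos_int.
Qed.

Definition near_lattice (x0 : 'rV[R]_d) rho : set 'rV[R]_d :=
  [set x | exists l : 'rV[int]_d, `|x - intvec l - x0| <= rho].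

(** The non-strict inequalities between cosines define a closed set [C] that contains the
    nonvanishing set, hence its closure; the integer vector is then read off coordinate by
    coordinate. *)
Lemma lattice_bump_support x0 rho : 0 < rho -> rho <= 2^-1 ->
  closure [set x | lattice_bump x0 rho x != 0] `<=` near_lattice x0 rho.
Proof.
move=> r0 r2.
pose C := \bigcap_(i in [set: 'I_d]) [set x : 'rV[R]_d |
   cos (rho *+ 2 * pi) <= cos ((x ord0 i - x0 ord0 i) *+ 2 * pi)].
have cC : closed C.
  apply: closed_bigI => i _.
  apply: (@preimage_closed _ _
    (fun x : 'rV[R]_d => cos ((x ord0 i - x0 ord0 i) *+ 2 * pi))
    [set t | cos (rho *+ 2 * pi) <= t]); last exact: closed_ge.
  move=> x _.
  apply: (@continuous_comp _ _ _ (fun x : 'rV[R]_d => x ord0 i)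
    (fun t => cos ((t - x0 ord0 i) *+ 2 * pi))).
    exact: coord_continuous.
  have [g _ Dg] := trig_flat_derive (trig_flat_cos (x0 ord0 i) 0).
  by have [+ _] := Dg (x ord0 i) => /derivable1_diffP/differentiable_continuous.
have sub : [set x | lattice_bump x0 rho x != 0] `<=` C.
  move=> x /= /prodf_neq0 H i _; have := H i isT.
  by rewrite flat0_neq0 subr_gt0 => /ltW.
move=> x /(closureS sub); rewrite -(closure_id C).1// => Cx.
have P i : {n : int | `|x ord0 i - x0 ord0 i - n%:~R| <= rho}.
  by apply: cid; apply: cos_ge_near_int => //; exact: Cx.
exists (\row_i sval (P i)); apply: norm_rV_le => [|i]; first exact: ltW.
by rewrite !mxE addrAC; exact: svalP (P i).
Qed.

Lemma lattice_bump_near_lattice x0 rho x : 0 < rho -> rho <= 2^-1 ->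
  lattice_bump x0 rho x != 0 -> near_lattice x0 rho x.
Proof. by move=> r0 r2 bx; apply: lattice_bump_support => //;
  exact: subset_closure. Qed.

Lemma measurable_lattice_bump x0 rho : measurable_fun setT (lattice_bump x0 rho).
Proof.
apply: measurable_prod => i _.
apply: (@measurableT_comp _ _ _ _ _ _
  (flat_cos (x0 ord0 i) (cos (rho *+ 2 * pi)) 0));
    last exact: measurable_rV_coord.
apply: continuous_measurable_fun => t.
have [g _ Dg] := trig_flat_derive (trig_flat_bump (x0 ord0 i) (cos (rho *+ 2 * pi)) 0).
by have [+ _] := Dg t => /derivable1_diffP/differentiable_continuous.
Qed.

(** A zero integral would make the bump vanish almost everywhere on the cube, whereas it is positive
    on the box [B] of positive measure. *)
Lemma lattice_bump_integral_gt0 x0 rho : 0 < rho -> rho <= 2^-1 ->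
  0 < \int[mu]_(x in unit_cube) lattice_bump x0 rho x.
Proof.
move=> r0 r2; rewrite lt_def Rintegral_ge0 ?andbT; last first.
  by move=> x _; exact: lattice_bump_ge0.
apply/eqP => I0.
(* [s] represents [x0] in the unit cube; the box extends from it by [rho], cut at 1 so as to stay
   inside the cube. *)
pose s i := (x0 - intvec (floorvec x0)) ord0 i.
pose e i := Num.min (s i + rho) 1.
have se i : 0 <= s i /\ s i < e i.
  have /andP[s0 s1] := floorvec_itv x0 i; split => //.
  by rewrite lt_min s1 ltrDl r0.
pose B := [set x : 'rV[R]_d | forall i, `[s i, e i[%classic (x ord0 i)].
have muB : mu B = (\prod_i (e i - s i))%:E.
  apply: (@lebesgue_rV_box _ _ (fun i => `[s i, e i[%classic)
    (fun i => e i - s i)) => i; first exact: measurable_itv.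
  by rewrite lebesgue_measure_itv/= lte_fin (se i).2.
have : mu B != 0%E.
  rewrite muB; apply/eqP => -[/eqP]; apply/negP;
    rewrite gt_eqF// prodr_gt0// => i _.
  by rewrite subr_gt0 (se i).2.
move/eqP; apply.
have mB : measurable B.
  apply: (@measurable_box _ _ (fun i => `[s i, e i[%classic)) => i.
  exact: measurable_itv.
apply/negligibleP => //.
have mb : measurable_fun unit_cube (EFin \o lattice_bump x0 rho).
  by apply/measurable_EFinP; apply: measurable_funTS;
    exact: measurable_lattice_bump.
have [/(_ _)+ _] := ae_eq_integral_abs mu (@measurable_unit_cube R d) mb.
have Ifin : (\int[mu]_(x in unit_cube) `|(EFin \o lattice_bump x0 rho) x| <= 1)%E.
  apply: (@le_trans _ _ (\int[mu]_(x in unit_cube) cst 1 x)%E).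
    apply: ge0_le_integral => //.
    - exact: measurable_unit_cube.
    - exact: measurableT_comp.
    - by move=> x _ /=;
      rewrite lee_fin ger0_norm ?lattice_bump_ge0// lattice_bump_le1.
  rewrite integral_cst; last exact: measurable_unit_cube.
  by rewrite mul1e [X in (X <= _)%E]lebesgue_unit_cube.
have E : (\int[mu]_(x in unit_cube) `|(EFin \o lattice_bump x0 rho) x| =
    \int[mu]_(x in unit_cube) (lattice_bump x0 rho x)%:E)%E.
  by apply: eq_integral => x _ /=; rewrite ger0_norm// lattice_bump_ge0.
rewrite E in Ifin *; move=> /(_ _)[|N [mN N0 sN]].
  move: I0; rewrite /Rintegral => /eqP; rewrite fine_eq0 => [/eqP //|].
  rewrite ge0_fin_numE; first exact: le_lt_trans Ifin (ltry 1).
  by apply: integral_ge0 => x _; rewrite lee_fin; exact: lattice_bump_ge0.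
exists N; split => // x Bx; apply: sN => /= H.
have cx : unit_cube x.
  move=> i; have := Bx i; rewrite /= in_itv/= => /andP[H0 H1].
  rewrite (le_trans (se i).1 H0)/=; apply: lt_le_trans H1 _.
  by rewrite ge_min lexx orbT.
have := H cx => -[] /eqP; apply/negP; rewrite gt_eqF//.
apply: prodr_gt0 => i _.
rewrite lt_def flat0_ge0 flat0_neq0 andbT subr_gt0.
have := Bx i; rewrite /= in_itv/= => /andP[H0 H1].
rewrite (_ : x ord0 i - x0 ord0 i =
    x ord0 i - s i + (- floorvec x0 ord0 i)%:~R); last first.
  by rewrite /s !mxE mulrNz; ring.
rewrite cos_int; apply: cos_lt_small => //; first lra.
have : e i <= s i + rho by rewrite /e ge_min lexx.
by move: H1; lra.
Qed.

End bump.

(** * Block scheduling *)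

Lemma recurrent_enumeration (B : countType) (b0 : B) :
  exists f : nat -> B, forall b N, exists2 s, (N <= s)%N & f s = b.
Proof.
(* The 2-adic valuation of [s.+1] takes each value infinitely often. In [m] the power of 2 carries
   the code of [b], and the odd factor makes [m] exceed [N]. *)
exists (fun s => odflt b0 (choice.unpickle (logn 2 s.+1))) => b N.
pose m := (2 ^ choice.pickle b * N.*2.+1)%N.
have m0 : (0 < m)%N by rewrite muln_gt0 expn_gt0.
have Nm : (N < m)%N.
  rewrite /m; apply: (@leq_trans N.*2.+1);
    first by rewrite ltnS -addnn leq_addr.
  by rewrite leq_pmull// expn_gt0.
exists m.-1; first by rewrite -ltnS prednK.
rewrite prednK// /m lognM ?expn_gt0// pfactorK// logn_coprime ?addn0 ?choice.pickleK//.
by rewrite prime_coprime// dvdn2/= odd_double.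
Qed.

Section block_scheduling.
Context {R : realType} {A : Type} {B : countType}.
Variables (G : B -> set A) (V : nat -> A -> R) (e : A -> R) (K : nat -> R).
Hypotheses (V_ge0 : forall j a, 0 <= V j a) (e_gt0 : forall a, 0 < e a).
Hypothesis G_unbounded : forall b J Q, exists2 a, G b a &
  exists J', Q * e a < \sum_(J <= j < J') V j a.

(** In the application, [a] is a bump of mass [e a], [V j a] its largest pairing with a layer of
    scale [j], [K J * e a] a bound for the scales before [J], and [G b] a group of small bumps at
    one point. *)
Let divergent a := forall Q, exists J, Q < \sum_(0 <= j < J) V j a.

Let sum_mono a J J1 J2 : (J1 <= J2)%N ->
  \sum_(J <= j < J1) V j a <= \sum_(J <= j < J2) V j a.
Proof.
move=> J12; have [JJ1|/ltnW J1J] := leqP J J1.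
  by rewrite (@big_cat_nat _ _ _ J1 J J2)//= lerDl sumr_ge0.
by rewrite big_geq// sumr_ge0.
Qed.

Let divergentP a J : divergent a -> exists J', 1 <= \sum_(J <= j < J') V j a.
Proof.
move=> /(_ (1 + \sum_(0 <= j < J) V j a))[J' HJ']; exists (maxn J J').
have := sum_mono a 0 (leq_maxr J J');
  rewrite (@big_cat_nat _ _ _ J 0 (maxn J J'))//=; last first.
  exact: leq_maxl.
lra.
Qed.

(** The partial sums have a supremum; past one that is within [e a] of it, at most [e a] remains. *)
Let tailP a J : ~ divergent a -> exists2 J', (J <= J')%N &
  forall J2, \sum_(J' <= j < J2) V j a <= e a.
Proof.
move=> /existsNP[Q /forallNP HQ].
pose S := [set \sum_(0 <= j < J) V j a | J in [set: nat]].
have hS : has_sup S.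
  split; first by exists (\sum_(0 <= j < 0) V j a); exists 0%N.
  by exists Q => _ [n _ <-]; rewrite leNgt; apply/negP; exact: HQ.
have [_ [J1 _ <-] HJ1] := sup_adherent (e_gt0 a) hS.
exists (maxn J J1); first exact: leq_maxl.
move=> J2; have [h|/ltnW h] := leqP (maxn J J1) J2; last first.
  by rewrite big_geq// ltW.
have H2 : \sum_(0 <= j < J2) V j a <= sup S.
  by apply: sup_upper_bound => //; exists J2.
have := sum_mono a 0 (leq_maxr J J1).
by move: H2; rewrite (@big_cat_nat _ _ _ (maxn J J1) 0 J2)//=; lra.
Qed.

(** A stage devotes the scales from [J] to [p.2] to the element [p.1]. In the second kind, the
    margin [K J + M + 1] pays for the earlier scales, for the tail, and leaves [M]. *)
Let stage_ok b M J (p : A * nat) :=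
  [/\ G b p.1, (J < p.2)%N &
  (divergent p.1 /\ 1 <= \sum_(J <= j < p.2) V j p.1) \/
  ((K J + M%:R + 1) * e p.1 < \sum_(J <= j < p.2) V j p.1 /\
   forall J2, \sum_(p.2 <= j < J2) V j p.1 <= e p.1)].

(* All stages of a group with a divergent element test the same element [dv b]:
   block sums at least 1 then recur along a single sequence, which is not
   Cauchy. *)
Let stage : exists dv : B -> A, forall b M J, exists p, stage_ok b M J p /\
  ((exists2 a, G b a & divergent a) -> divergent p.1 /\ p.1 = dv b).
Proof.
have P b : {a | (exists2 a, G b a & divergent a) -> G b a /\ divergent a}.
  apply: cid; have [[a Ga da]|H] := pselect (exists2 a, G b a & divergent a).
    by exists a.
  by have [a _ _] := G_unbounded b 0 0; exists a.
exists (fun b => sval (P b)) => b M J.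
have [H|H] := pselect (exists2 a, G b a & divergent a).
  have [Ga da] := svalP (P b) H; have [J' HJ'] := divergentP J da.
  exists (sval (P b), maxn J.+1 J'); split=> //; split => //=.
    exact: leq_maxl.
  left; split=> //; apply: le_trans HJ' _; apply: sum_mono; exact: leq_maxr.
have [a Ga [J1 HJ1]] := G_unbounded b J (K J + M%:R + 1).
have nda : ~ divergent a by move=> da; apply: H; exists a.
have [J' JJ' HJ'] := tailP (maxn J.+1 J1) nda.
move: JJ'; rewrite geq_max => /andP[JJ' J1J'].
exists (a, J'); split=> [|/H//]; split => //=; right; split => //.
by apply: lt_le_trans HJ1 _; exact: sum_mono.
Qed.

(** Stages occupy consecutive blocks of scales, [tau] giving the element tested at each scale. Every
    group recurs infinitely often, and stage [s] is played with [M = s]: a group either has an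
    element with divergent pairings or defeats every constant bound. *)
Lemma block_schedule (b0 : B) : exists tau : nat -> A,
  forall w : nat -> A -> R,
  (forall j a, `|w j a| <= V j a) ->
  (forall J a, `|\sum_(0 <= j < J) w j a| <= K J * e a) ->
  (forall j, w j (tau j) = V j (tau j)) ->
  forall b (M : R), ~ forall a, G b a -> exists2 l, `|l| <= M * e a &
    \sum_(0 <= j < J) w j a @[J --> \oo] --> l.
Proof.
have [f fP] := recurrent_enumeration b0.
have [dv dvP] := stage.
pose st s J := sval (cid (dvP (f s) s J)).
pose fix T s := if s is s'.+1 then (st s' (T s')).2 else 0%N.
pose al s := (st s (T s)).1.
have stP s : stage_ok (f s) s (T s) (al s, T s.+1) /\
    ((exists2 a, G (f s) a & divergent a) -> divergent (al s) /\ al s = dv (f s)).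
  have := svalP (cid (dvP (f s) s (T s))); rewrite -/(st s (T s)) /al /=.
  by case: (st s (T s)).
have TS s : (T s < T s.+1)%N by have [[_ + _] _] := stP s.
have Tmono s s' : (s <= s')%N -> (T s <= T s')%N.
  by apply: (homo_leq (r := leq)) => //; [exact: leq_trans|move=> n;
    exact/ltnW].
have Tid s : (s <= T s)%N.
  by elim: s => // s ih; exact: leq_ltn_trans ih (TS s).
(* As [T] increases strictly from 0, the blocks partition the scales. *)
have blk j : {s | (T s <= j < T s.+1)%N}.
  apply: cid; elim: j => [|j [s /andP[s1 s2]]].
    by exists 0%N; exact: leq_ltn_trans (leq0n _) (TS 0%N).
  have [h|h] := ltnP j.+1 (T s.+1); first by exists s; rewrite h andbT ltnW.
  exists s.+1; rewrite h /=; apply: leq_ltn_trans (TS _); exact: s2.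
exists (fun j => al (sval (blk j))) => w wV wK wtau b M Hl.
have blkE s j : (T s <= j < T s.+1)%N -> sval (blk j) = s.
  move=> /andP[h1 h2]; have /andP[h3 h4] := svalP (blk j).
  apply/eqP; rewrite eqn_leq; apply/andP; split; rewrite leqNgt;
    apply/negP => h.
    by have := leq_trans h2 (leq_trans (Tmono _ _ h) h3); rewrite ltnn.
  by have := leq_trans h4 (leq_trans (Tmono _ _ h) h1); rewrite ltnn.
have wblk s : \sum_(T s <= j < T s.+1) w j (al s) =
    \sum_(T s <= j < T s.+1) V j (al s).
  rewrite big_nat [RHS]big_nat; apply: eq_bigr => j hj.
  by have := wtau j; rewrite (blkE _ _ hj).
have split_sum s J a : (T s <= J)%N -> \sum_(0 <= j < J) w j a =
    \sum_(0 <= j < T s) w j a + \sum_(T s <= j < J) w j a.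
  by move=> h; rewrite (@big_cat_nat _ _ _ (T s) 0 J).
(* In the divergent case, infinitely many blocks test the same element and each adds at least 1 to
   its partial sums, which are therefore not Cauchy. *)
have [H|H] := pselect (exists2 a, G b a & divergent a).
  have [s0 _ fs0] := fP b 0%N.
  have [[Ga _ _] da] := stP s0.
  rewrite /= fs0 in Ga da; have [da1 da2] := da H.
  have [l _ /cvgrPdist_lt/(_ (1/2))] := Hl _ Ga.
  rewrite divr_gt0// => /(_ isT)[N _ HN].
  have [s Ns fs] := fP b N.
  have [[Ga' _ ok] da'] := stP s; rewrite /= fs in da' Ga' ok;
    have [da1' da2'] := da' H.
  have aE : al s = al s0 by rewrite da2' da2.
  have N1 : (N <= T s)%N by exact: leq_trans Ns (Tid s).
  have := HN _ N1; have := HN _ (leq_trans N1 (ltnW (TS s))); rewrite /= -aE.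
  rewrite (split_sum s (T s.+1))// ?wblk; last exact/ltnW.
  have : 1 <= \sum_(T s <= j < T s.+1) V j (al s).
    (* The second kind of stage is impossible here: its bounded tail contradicts divergence. *)
    case: ok => [[_]//|[_ /(_ _) HT]].
    have [Q HQ] := da1' (\sum_(0 <= j < T s.+1) V j (al s) + e (al s)).
    exfalso; move: HQ; apply/negP; rewrite -leNgt.
    apply: le_trans (sum_mono _ 0 (leq_maxr (T s.+1) Q)) _.
    by rewrite (@big_cat_nat _ _ _ (T s.+1) 0)//= ?leq_maxl// lerD2l; exact: HT.
  rewrite !ltr_norml; lra.
pose N := Num.bound `|M|.
have [s Ns fs] := fP b N.
have [[Ga _ ok] _] := stP s; rewrite fs /= in Ga ok.
have Ms : M < s%:R.
  apply: le_lt_trans (ler_norm _) _;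
    apply: lt_le_trans (archi_boundP (normr_ge0 M)) _.
  by rewrite ler_nat.
case: ok => [[da _]|[big tl]]; first by apply: H; exists (al s).
have [l lM lw] := Hl _ Ga.
(* In units of [e (al s)], the block gives more than [K + s + 1], the earlier scales take away at
   most [K] and the later ones at most 1. As [s > M], the bound on [l] fails. *)
have : s%:R * e (al s) <= l.
  rewrite -(cvg_lim _ lw)//; apply: limr_ge; first exact: cvgP lw.
  exists (T s.+1) => // J /= TJ.
  have h1 : (T s <= J)%N := leq_trans (ltnW (TS s)) TJ.
  rewrite (split_sum s.+1)// (split_sum s (T s.+1)) ?wblk; last exact/ltnW.
  have := wK (T s) (al s); rewrite ler_norml => /andP[H1 _].
  have : - e (al s) <= \sum_(T s.+1 <= j < J) w j (al s).
    have : `|\sum_(T s.+1 <= j < J) w j (al s)| <= e (al s).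
      apply: le_trans (ler_norm_sum _ _ _) _; apply: le_trans (tl J).
      by apply: ler_sum => j _.
    by rewrite ler_norml => /andP[].
  move: big H1; lra.
have := ler_norm l; have := e_gt0 (al s); nra.
Qed.

End block_scheduling.

(** * Integration over the unit cube *)

Section cube_integral.
Context {R : realType} {d : nat}.
Local Notation mu := (@lebesgue_rV R d).
Local Notation cube := (@unit_cube R d).
Implicit Types f g : 'rV[R]_d -> R.

Definition cube_bounded f :=
  measurable_fun cube f /\ exists M : R, forall x, cube x -> `|f x| <= M.

Lemma cube_bounded_integrable f : cube_bounded f ->
  mu.-integrable cube (EFin \o f).
Proof.
move=> [mf [M HM]]; apply: measurable_bounded_integrable => //.
- exact: measurable_unit_cube.
- by rewrite [X in (X < _)%E]lebesgue_unit_cube ltry.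
exists `|M|; split; first exact: num_real.
move=> M' MM' x /= xc; apply: le_trans (HM x xc) _.
exact: le_trans (ler_norm M) (ltW MM').
Qed.

Lemma cube_bounded_sum (I : Type) (s : seq I) (f : I -> 'rV[R]_d -> R) :
  (forall i, cube_bounded (f i)) ->
  cube_bounded (fun x => \sum_(i <- s) f i x).
Proof.
move=> cf; split; first by apply: measurable_sum => i; exact: (cf i).1.
have P i : {M : R | forall x, cube x -> `|f i x| <= M}.
  by apply: cid; exact: (cf i).2.
exists (\sum_(i <- s) sval (P i)) => x xc.
apply: le_trans (ler_norm_sum _ _ _) _; apply: ler_sum => i _.
exact: svalP (P i) x xc.
Qed.

Lemma cube_boundedM f g : cube_bounded f -> cube_bounded g ->
  cube_bounded (fun x => f x * g x).
Proof.
move=> [mf [M HM]] [mg [N HN]]; split; first exact: measurable_funM.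
exists (M * N) => x xc; rewrite normrM.
by apply: ler_pM => //; [exact: HM|exact: HN].
Qed.

Lemma cube_boundedZ f (c : R) : cube_bounded f -> cube_bounded (fun x => c * f x).
Proof.
apply: cube_boundedM; split; first exact: measurable_cst.
by exists `|c|.
Qed.

Lemma Rintegral_cube_sum (I : Type) (s : seq I) (f : I -> 'rV[R]_d -> R) :
  (forall i, cube_bounded (f i)) ->
  \int[mu]_(x in cube) (\sum_(i <- s) f i x)
  = \sum_(i <- s) \int[mu]_(x in cube) f i x.
Proof.
move=> cf; elim: s => [|i s ih].
  rewrite big_nil; under eq_Rintegral do rewrite big_nil.
  by rewrite Rintegral_cst ?mul0r//; exact: measurable_unit_cube.
rewrite big_cons -ih -RintegralD//;
  first by under eq_Rintegral do rewrite big_cons.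
- exact: measurable_unit_cube.
- exact: cube_bounded_integrable.
- by apply: cube_bounded_integrable; exact: cube_bounded_sum.
Qed.

Lemma Rintegral_cubeZ f (c : R) : cube_bounded f ->
  \int[mu]_(x in cube) (c * f x) = c * \int[mu]_(x in cube) f x.
Proof.
move=> cf; apply: RintegralZl; first exact: measurable_unit_cube.
exact: cube_bounded_integrable.
Qed.

Lemma le_Rintegral_cube f g : cube_bounded f -> cube_bounded g ->
  (forall x, cube x -> f x <= g x) ->
  \int[mu]_(x in cube) f x <= \int[mu]_(x in cube) g x.
Proof.
move=> cf cg fg; apply: le_Rintegral => //.
- exact: measurable_unit_cube.
- exact: cube_bounded_integrable.
- exact: cube_bounded_integrable.
Qed.

Lemma norm_Rintegral_cube f g : cube_bounded f -> cube_bounded g ->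
  (forall x, cube x -> `|f x| <= g x) ->
  `|\int[mu]_(x in cube) f x| <= \int[mu]_(x in cube) g x.
Proof.
move=> cf cg fg; rewrite ler_norml; apply/andP; split; last first.
  by apply: le_Rintegral_cube => // x xc; apply: le_trans (fg x xc);
    exact: ler_norm.
rewrite lerNl -mulN1r -Rintegral_cubeZ//; apply: le_Rintegral_cube => //.
  exact: cube_boundedZ.
move=> x xc; rewrite mulN1r; apply: le_trans (fg x xc).
by rewrite -normrN ler_norm.
Qed.

Lemma cube_bounded_lattice_bump x0 rho : cube_bounded (@lattice_bump R d x0 rho).
Proof.
split; first by apply: measurable_funTS; exact: measurable_lattice_bump.
by exists 1 => x _; rewrite ger0_norm ?lattice_bump_ge0// lattice_bump_le1.
Qed.

Lemma cube_bounded_periodized psi j (k : @dyadic d j) : fast_decay psi ->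
  measurable_fun setT psi -> cube_bounded (periodized psi j (dyadic_vec k)).
Proof.
move=> fd mpsi; split; first exact: measurable_periodized.
have [C HC] := sum_periodized_bounded fd; exists C => x _.
by apply: le_trans (HC j x); rewrite (bigD1 k)//= lerDl sumr_ge0.
Qed.

(** The essential bound of [g] on [U] gives a constant independent of [theta]; this is the property
    that [block_schedule] contradicts. *)
Lemma Linfty_pairing (U : set 'rV[R]_d) g : open U -> Linfty_on U g ->
  exists M : R, forall theta, cube_bounded theta -> (forall x, 0 <= theta x) ->
  `|\int[mu]_(x in cube `&` U) (g x * theta x)| <=
  M * \int[mu]_(x in cube) theta x.
Proof.
move=> oU [_ mg [M aeM]]; exists `|M| => theta bth th0.
have mU : measurable U by exact: measurable_open_rV.
have mC := @measurable_unit_cube R d.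
have mD : measurable (cube `&` U) by exact: measurableI.
pose f x := g x * theta x.
have mf : measurable_fun (cube `&` U) f.
  apply: measurable_funM.
    by apply: measurable_funS mg => //; exact: subIsetr.
  by apply: measurable_funS bth.1 => //; exact: subIsetl.
have mMth : measurable_fun cube (fun x => `|M| * theta x).
  by have [] := cube_boundedZ `|M| bth.
have ith : (\int[mu]_(x in cube) (`|M| * theta x)%:E =
    (`|M| * \int[mu]_(x in cube) theta x)%:E)%E.
  rewrite -Rintegral_cubeZ// /Rintegral fineK//.
  by apply: integrable_fin_num => //; apply: cube_bounded_integrable;
    exact: cube_boundedZ.
have fle : (`|\int[mu]_(x in cube `&` U) (f x)%:E| <=
    (`|M| * \int[mu]_(x in cube) theta x)%:E)%E.
  apply: le_trans (le_abse_integral _ mD _) _; first exact/measurable_EFinP.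
  rewrite -ith.
  apply: (@le_trans _ _ (\int[mu]_(x in cube `&` U) (`|M| * theta x)%:E)%E).
    apply: ae_ge0_le_integral => //.
    - by apply: measurableT_comp => //; exact/measurable_EFinP.
    - by move=> x _; rewrite lee_fin mulr_ge0.
    - apply/measurable_EFinP; apply: measurable_funS mMth => //;
      exact: subIsetl.
    move: aeM; apply: filterS => x Ux [_ /Ux gM].
    rewrite /f abse_EFin lee_fin normrM (ger0_norm (th0 x)) ler_wpM2r//.
    exact: le_trans gM (ler_norm M).
  apply: ge0_subset_integral => //; first exact/measurable_EFinP.
  by move=> x _; rewrite lee_fin mulr_ge0.
have fin : (\int[mu]_(x in cube `&` U) (f x)%:E)%E \is a fin_num.
  by rewrite fin_num_abs; exact: le_lt_trans fle (ltry _).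
by move: fle; rewrite -[X in `|X|%E]fineK// abse_EFin lee_fin.
Qed.

End cube_integral.

(** * Dyadic preimages of periodic points *)

(** If each of the [q] classes had bounded sums from some scale on, adding the bounds would bound
    the whole series. Divergence from every [J] allows finitely many scales to be discarded. *)
Lemma divergent_residue_class {R : realType} (omega : nat -> R) (q : nat) :
  (0 < q)%N -> (forall j, 0 <= omega j) ->
  (\sum_(0 <= j <oo) (omega j)%:E = +oo)%E ->
  exists r, forall J Q, exists J',
    Q < \sum_(J <= j < J' | j == r %[mod q]) omega j.
Proof.
move=> q0 o0 oinf; apply: contrapT => /forallNP H.
have P (r : 'I_q) : {JQ : nat * R | forall J',
    \sum_(JQ.1 <= j < J' | j == r %[mod q]) omega j <= JQ.2}.
  apply: cid; have /existsNP[J /existsNP[Q /forallNP HQ]] := H r.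
  by exists (J, Q) => J'; rewrite leNgt; apply/negP; exact: HQ.
pose C := \sum_(r < q) (\sum_(0 <= j < (sval (P r)).1) omega j + (sval (P r)).2).
suff : (\sum_(0 <= j <oo) (omega j)%:E <= C%:E)%E by rewrite oinf leye_eq.
apply: lime_le; first by apply: is_cvg_nneseries => j _; rewrite lee_fin.
apply: nearW => J'; rewrite sumEFin lee_fin.
rewrite (eq_bigr (fun j =>
  \sum_(r < q) if j == r %[mod q] then omega j else 0)); last first.
  move=> j _; rewrite (bigD1 (Ordinal (ltn_pmod j q0)))//= modn_mod eqxx.
  rewrite big1 ?addr0// => r; rewrite -val_eqE/= => rj.
  by rewrite (modn_small (ltn_ord r)) eq_sym (negbTE rj).
rewrite exchange_big/=; apply: ler_sum => r _; rewrite -big_mkcond/=.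
set J := (sval (P r)).1; have HP := svalP (P r).
have sub a b : \sum_(a <= j < b | j == r %[mod q]) omega j <=
    \sum_(a <= j < b) omega j.
  by rewrite big_mkcond; apply: ler_sum => j _; case: ifP.
have [JJ'|J'J] := leqP J J'.
  by rewrite (@big_cat_nat _ _ _ J 0 J')//= lerD//; exact: HP.
(* For [J' < J], an empty sum shows that the bound attached to the class is nonnegative. *)
rewrite -[leLHS]addr0 lerD//; last first.
  by have := HP 0%N; rewrite big_geq.
apply: le_trans (sub _ _) _.
rewrite (@big_cat_nat _ _ _ J' 0 J)//=; last exact: ltnW.
by rewrite lerDl sumr_ge0.
Qed.

Section dyadic_points.
Context {R : realType} {d : nat}.
Implicit Types (x y : 'rV[R]_d) (m l : 'rV[int]_d).

Lemma pow2_neq0 j : 2 ^+ j != 0 :> R.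
Proof. by rewrite expf_neq0. Qed.

(* [y = a / (2^q - 1)] *)
Lemma approx_periodic_point x (eta : R) : 0 < eta ->
  exists q y a, [/\ (0 < q)%N, `|y - x| < eta &
    2 ^+ q *: y - y = intvec a].
Proof.
move=> e0; pose q := (Num.bound eta^-1).+1.
have q1 : eta^-1 < 2 ^+ q - 1.
  have ei : 0 <= eta^-1 by rewrite invr_ge0 ltW.
  apply: lt_le_trans (archi_boundP ei) _.
  rewrite lerBrDr -natrX -(natrD _ _ 1) ler_nat addn1; exact/ltnW/ltn_expl.
have D0 : 0 < 2 ^+ q - 1 :> R by apply: lt_trans q1; rewrite invr_gt0.
pose D : R := 2 ^+ q - 1.
pose a := floorvec (D *: x).
exists q, (D^-1 *: intvec a), a; split=> //.
  rewrite (_ : _ - x = D^-1 *: (intvec a - D *: x)); last first.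
    by rewrite scalerBr scalerA mulVf ?gt_eqF// scale1r.
  rewrite normrZ normfV (gtr0_norm D0) mulrC ltr_pdivrMr//.
  rewrite distrC; apply: le_lt_trans (norm_floorvec _) _.
  by rewrite -[ltLHS](mulfV (lt0r_neq0 e0)) ltr_pM2l.
rewrite -[X in _ - X]scale1r -scalerBl scalerA mulfV ?scale1r// gt_eqF//.
Qed.

Lemma iter_periodic_point q y a : 2 ^+ q *: y - y = intvec a ->
  forall n, exists p, 2 ^+ (q * n) *: y = y + intvec p.
Proof.
move=> ya; elim=> [|n [p Hp]].
  by exists 0; rewrite muln0 expr0 scale1r intvec0 addr0.
exists (a + (2 ^ q)%N%:Z *: p).
rewrite mulnS exprD -scalerA Hp scalerDr intvecD -ya intvecZ natrX.
by rewrite addrA [y + _]addrC subrK.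
Qed.

(** Dilation by [2^(r + q n)] sends this point to [y] modulo Z^d; when [2^q y = y] modulo Z^d, it
    returns there at each further multiple of [q] scales. *)
Definition lattice_point (r q : nat) y (n : nat) m : 'rV[R]_d :=
  (2 ^+ (r + q * n))^-1 *: (y + intvec m).

Lemma lattice_point_dilation r q y a n m j : 2 ^+ q *: y - y = intvec a ->
  (r + q * n <= j)%N -> j = r %[mod q] ->
  exists p, 2 ^+ j *: lattice_point r q y n m = y + intvec p.
Proof.
move=> ya nj jr.
have [k ->] : exists k, j = (q * k + (r + q * n))%N.
  exists ((j - (r + q * n)) %/ q)%N; rewrite mulnC divnK ?subnK//.
  by rewrite -eqn_mod_dvd// jr mulnC addnC modnMDl.
have [p Hp] := iter_periodic_point ya k.
exists (p + (2 ^ (q * k))%N%:Z *: m).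
rewrite exprD /lattice_point scalerA mulrK ?unitfE ?pow2_neq0//.
by rewrite scalerDr Hp intvecD intvecZ natrX addrA.
Qed.

Lemma lattice_point_dense r q y x (e : R) : (0 < q)%N -> 0 < e ->
  exists n m, `|lattice_point r q y n m - x| < e.
Proof.
move=> q0 e0; pose n := Num.bound e^-1; exists n.
pose D : R := 2 ^+ (r + q * n); have D0 : 0 < D by rewrite exprn_gt0.
have De : e^-1 < D.
  have ei : 0 <= e^-1 by rewrite invr_ge0 ltW.
  apply: lt_le_trans (archi_boundP ei) _; rewrite /D -natrX ler_nat.
  apply: (@leq_trans (r + q * n)); last exact/ltnW/ltn_expl.
  by apply: leq_trans (leq_addl _ _); rewrite leq_pmull.
exists (floorvec (D *: x - y)).
rewrite (_ : _ - x = - (D^-1 *: (D *: x - y - intvec (floorvec (D *: x - y))))).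
  rewrite normrN normrZ normfV (gtr0_norm D0) mulrC ltr_pdivrMr//.
  apply: le_lt_trans (norm_floorvec _) _.
  by rewrite -[ltLHS](mulfV (lt0r_neq0 e0)) ltr_pM2l.
rewrite -[_ - y - _]addrA -opprD scalerBr scalerA mulVf ?gt_eqF// scale1r opprB//.
Qed.

Lemma dyadic_decomposition j (p : 'rV[int]_d) :
  exists (k : @dyadic d j) l, p = (2 ^ j)%N%:Z *: l + dyadic_vec k.
Proof.
have j0 : (0 < 2 ^ j)%N by rewrite expn_gt0.
have P (i : 'I_d) : (`|(p ord0 i %% (2 ^ j)%N%:Z)%Z| < 2 ^ j)%N.
  rewrite -ltz_nat gez0_abs ?modz_ge0 ?ltz_pmod//; last by rewrite gt_eqF.
exists [ffun i => Ordinal (P i)], (\row_i (p ord0 i %/ (2 ^ j)%N%:Z)%Z).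
apply/rowP => i; rewrite !mxE ffunE/= gez0_abs ?modz_ge0//;
  last by rewrite gt_eqF.
by rewrite mulrC -divz_eq.
Qed.

(** Shifting the summation index by [l] makes the term [l' = 0] the wavelet translated by
    [2^j l + k], a lattice point that can be taken near [2^j x] although [k] is confined to a
    fundamental domain. *)
Lemma periodized_recenter (psi : 'rV[R]_d -> R) j (k : @dyadic d j) l x :
  periodized psi j (dyadic_vec k) x =
  sum_Zd (fun l' => psi ((2 ^+ j *: x -
     intvec ((2 ^ j)%N%:Z *: l + dyadic_vec k)) - intvec ((2 ^ j)%N%:Z *: l'))).
Proof.
rewrite /periodized -(@sum_Zd_reindex _ _ _ (fun l' => l' + l)); last first.
  by exists (fun l' => l' - l) => l'; rewrite ?subrK ?addrK.
congr sum_Zd; apply/funext => l'; rewrite dilation_intvec; congr psi.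
rewrite -addrA -opprD -intvecD; congr (_ - intvec _).
by rewrite scalerDr -addrA addrC.
Qed.

(** After recentering at [p], the main term is at least [2 c] and the others cost at most [c]. Half
    of [eta] covers the distance from [y] to [x1], the other half the dilated radius. The threshold
    [j0] is common to all lattice points. *)
Lemma periodized_lower_bound (psi : 'rV[R]_d -> R) (x1 y : 'rV[R]_d)
    (s c eta : R) r q a :
  fast_decay psi -> 0 < c -> 0 < eta -> `|s| = 1 ->
  (forall z, `|z - x1| < eta -> 2 * c <= s * psi z) ->
  `|y - x1| < eta / 2 -> 2 ^+ q *: y - y = intvec a ->
  exists j0, forall n m j, (j0 <= j)%N -> (r + q * n <= j)%N ->
    j = r %[mod q] -> exists k : @dyadic d j, forall rho x,
    2 ^+ j * rho < eta / 2 -> near_lattice (lattice_point r q y n m) rho x ->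
    c <= s * periodized psi j (dyadic_vec k) x.
Proof.
move=> fd c0 e0 s1 psic yx ya.
have r0 : 0 <= `|y| + eta by rewrite addr_ge0// ltW.
have [j0 Hj0] := periodized_main_term fd r0 c0.
exists j0 => n m j j0j nj jr.
have [p Hp] := lattice_point_dilation m ya nj jr.
have [k [l pE]] := dyadic_decomposition j p; exists k => rho x jrho [l1 xl1].
rewrite -(subrK (intvec l1) x) periodized_periodic (periodized_recenter _ k l) -pE.
set z := 2 ^+ j *: _ - _.
have zy : `|z - y| < eta / 2.
  rewrite (_ : z - y = 2 ^+ j *: (x - intvec l1 - lattice_point r q y n m)).
    rewrite normrZ ger0_norm ?exprn_ge0//; apply: le_lt_trans jrho.
    by rewrite ler_wpM2l// exprn_ge0.
  by rewrite scalerBr Hp /z opprD addrA addrAC.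
have zx1 : `|z - x1| < eta.
  by have := ler_distD y z x1; lra.
have zr : `|z| <= `|y| + eta.
  by have := ler_distD y z 0; rewrite !subr0; lra.
have := Hj0 j z j0j zr; have := psic z zx1; set S := sum_Zd _.
have : `|s * (S - psi z)| = `|S - psi z| by rewrite normrM s1 mul1r.
move=> <- H1; rewrite ler_norml mulrBr => /andP[H2 _]; lra.
Qed.

End dyadic_points.

(** * Construction of the divergent series *)

Section nowhere_bounded.
Context {R : realType} {d : nat}.
Local Notation mu := (@lebesgue_rV R d).
Local Notation cube := (@unit_cube R d).
Variables (phi : 'rV[R]_d -> R) (Psi : 'I_(2 ^ d - 1) -> 'rV[R]_d -> R).
Hypothesis hPsi : smooth_wavelet_basis 0 phi Psi.

Lemma mother_waveletE i x : wavelet_system phi Psi (inr (0%N, 0, i)) x = Psi i x.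
Proof.
by rewrite /wavelet_system muln0 expr0 sqrtr1 mul1r scale1r intvec0 subr0.
Qed.

Lemma measurable_wavelet i : measurable_fun setT (Psi i).
Proof.
have [_ _ [/(_ (inr (0%N, 0, i)))/sub_Lfun_mfun + _ _]] := hPsi.
move=> /set_mem/= mf.
by rewrite (_ : Psi i = wavelet_system phi Psi (inr (0%N, 0, i)))//;
  apply/funext => x; rewrite mother_waveletE.
Qed.

Lemma wavelet_norm1 i : \int[mu]_(x in setT) (Psi i x * Psi i x) = 1.
Proof.
have [_ _ [_ /(_ (inr (0%N, 0, i)) (inr (0%N, 0, i))) + _]] := hPsi.
rewrite eqxx => E; apply: etrans E; apply: eq_Rintegral => x _.
by rewrite mother_waveletE.
Qed.

Lemma wavelet_bounded_below i : piecewise_continuous (Psi i) ->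
  exists x1 (s c eta : R), [/\ 0 < c, 0 < eta, `|s| = 1 &
    forall z, `|z - x1| < eta -> 2 * c <= s * Psi i z].
Proof.
move=> pc.
have [x1 cx nz] := piecewise_continuity_point (measurable_wavelet i) pc (wavelet_norm1 i).
have n0 : 0 < `|Psi i x1| by rewrite normr_gt0.
have h2 : 0 < `|Psi i x1| / 2 by rewrite divr_gt0.
move/continuous_rVP : cx => /(_ _ h2) /(@nbhs_ballP _ _ x1)[eta /= e0 H].
(* With a quarter of [|Psi i x1|] as [c], the required [2 c] is half of it, which a variation below
   the other half preserves. *)
exists x1, (Num.sg (Psi i x1)), (`|Psi i x1| / 4), eta; split => //.
- by rewrite divr_gt0.
- by rewrite normr_sg nz.
move=> z zx; have := H z; rewrite -ball_normE /= distrC => /(_ zx).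
have : `|Num.sg (Psi i x1) * (Psi i x1 - Psi i z)| = `|Psi i x1 - Psi i z|.
  by rewrite normrM normr_sg nz mul1r.
move=> <-; rewrite mulrBr -normrEsg ltr_norml; lra.
Qed.

(** The index 0 already gives the radius 1/2, the largest one that the bump lemmas allow. *)
Let theta (a : 'rV[R]_d * nat) := lattice_bump a.1 (a.2.+2%:R^-1 : R).
Let mass (a : 'rV[R]_d * nat) := \int[mu]_(x in cube) theta a x.

Let rho_gt0 n : 0 < n.+2%:R^-1 :> R.
Proof. by rewrite invr_gt0. Qed.

Let rho_le n : n.+2%:R^-1 <= 2^-1 :> R.
Proof. by rewrite lef_pV2 ?posrE// ler_nat. Qed.

Let mass_gt0 a : 0 < mass a.
Proof. exact: lattice_bump_integral_gt0. Qed.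

Let pairing j i (k : @dyadic d j) a :=
  \int[mu]_(x in cube) (periodized (Psi i) j (dyadic_vec k) x * theta a x).

Let cb_theta a : cube_bounded (theta a).
Proof. exact: cube_bounded_lattice_bump. Qed.

Let cb_per j i (k : @dyadic d j) :
  cube_bounded (periodized (Psi i) j (dyadic_vec k)).
Proof.
apply: cube_bounded_periodized; first exact: wavelet_fast_decay hPsi i.
exact: measurable_wavelet.
Qed.

Let cb_layer (c : @wavelet_coefs R d) j : cube_bounded (wavelet_layer Psi c j).
Proof.
apply: cube_bounded_sum => i; apply: cube_bounded_sum => k.
exact: cube_boundedZ.
Qed.

Let layer_pairing (c : @wavelet_coefs R d) j a :
  \int[mu]_(x in cube) (wavelet_layer Psi c j x * theta a x) =
  \sum_i \sum_k c j i k * pairing i k a.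
Proof.
have cb2 i (k : @dyadic d j) : cube_bounded (fun x => c j i k *
    (periodized (Psi i) j (dyadic_vec k) x * theta a x)).
  by apply: cube_boundedZ; exact: cube_boundedM.
transitivity (\int[mu]_(x in cube) (\sum_i \sum_k c j i k *
    (periodized (Psi i) j (dyadic_vec k) x * theta a x))).
  apply: eq_Rintegral => x _; rewrite mulr_suml; apply: eq_bigr => i _.
  by rewrite mulr_suml; apply: eq_bigr => k _; rewrite mulrA.
rewrite Rintegral_cube_sum; last by move=> i; exact: cube_bounded_sum.
apply: eq_bigr => i _; rewrite Rintegral_cube_sum//.
apply: eq_bigr => k _; rewrite Rintegral_cubeZ//; exact: cube_boundedM.
Qed.

Let partial_pairing (c : @wavelet_coefs R d) J a :
  \int[mu]_(x in cube) (wavelet_partial_sum Psi c J x * theta a x) =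
  \sum_(0 <= j < J.+1)
    \int[mu]_(x in cube) (wavelet_layer Psi c j x * theta a x).
Proof.
rewrite big_mkord -Rintegral_cube_sum; last by move=> j; exact: cube_boundedM.
by apply: eq_Rintegral => x _; rewrite mulr_suml.
Qed.

Let test_theta a (U : set 'rV[R]_d) :
  near_lattice a.1 a.2.+2%:R^-1 `<=` U -> test_function U (theta a).
Proof.
move=> aU; split; [exact: lattice_bump_smooth|exact: lattice_bump_periodic|].
by move=> x /lattice_bump_support H; apply: aU; exact: H.
Qed.

Lemma nowhere_bounded_series (i0 : 'I_(2 ^ d - 1)) (omega : nat -> R) :
  (forall j, 0 <= omega j) -> (\sum_(0 <= j <oo) (omega j)%:E = +oo)%E ->
  piecewise_continuous (Psi i0) ->
  exists c : @wavelet_coefs R d, (forall j, coefs_sup c j = omega j) /\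
    nowhere_locally_bounded (wavelet_partial_sum Psi c).
Proof.
move=> o0 oinf pc.
have [x1 [s [c0 [eta [c00 eta0 s1 psic]]]]] := wavelet_bounded_below pc.
have eta2 : 0 < eta / 2 by rewrite divr_gt0.
have [q [y [a0 [q0 yx ya]]]] := approx_periodic_point x1 eta2.
have [r rdiv] := divergent_residue_class q0 o0 oinf.
have [j0 Hj0] := periodized_lower_bound r
  (wavelet_fast_decay hPsi i0) c00 eta0 s1 psic yx ya.
have [C C0 HC] := wavelet_layer_bounded hPsi.
pose V j a := omega j * \sum_i \sum_(k : @dyadic d j) `|pairing i k a|.
pose K J := C * \sum_(0 <= j < J) omega j.
(* A group is given by a lattice point and a maximal radius: countably many groups, yet by density
   every nonempty periodic open set contains the supports of all bumps of some group. *)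
pose G (b : nat * 'rV[int]_d * nat) : set ('rV[R]_d * nat) :=
  [set a | a.1 = lattice_point r q y b.1.1 b.1.2 /\ (b.2 <= a.2)%N].
have V0 j a : 0 <= V j a.
  by rewrite mulr_ge0// sumr_ge0// => i _; exact: sumr_ge0.
have G_unbounded b J Q : exists2 a, G b a &
    exists J', Q * mass a < \sum_(J <= j < J') V j a.
  case: b => [[n m] N].
  (* Beyond [J1] the lower bound on wavelets holds; [Q / c0] below makes up for its factor [c0]. *)
  pose J1 := maxn J (maxn j0 (r + q * n)).
  have [J' HJ'] := rdiv J1 (Q / c0).
  (* The radius is chosen after [J'], so that it is small enough for all scales of the block at
     once. *)
  have [N1 HN1] : exists N1 : nat, 2 ^+ J' * 2 / eta < N1%:R.
    exists (Num.bound (2 ^+ J' * 2 / eta)); apply: archi_boundP.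
    by rewrite divr_ge0 ?mulr_ge0 ?exprn_ge0// ltW.
  pose a := (lattice_point r q y n m, maxn N N1).
  exists a; first by split => //=; exact: leq_maxl.
  exists J'.
  have Vlow j : (J1 <= j)%N -> (j < J')%N -> j = r %[mod q] ->
      omega j * (c0 * mass a) <= V j a.
    rewrite !geq_max => /and3P[Jj j0j nj] jJ' jr.
    have [k Hk] := Hj0 n m j j0j nj jr.
    have small : 2 ^+ j * (a.2.+2%:R^-1) < eta / 2.
      rewrite ltr_pdivrMr// mulrC -ltr_pdivrMr; last exact: eta2.
      rewrite invf_div mulrA; apply: (@le_lt_trans _ _ (2 ^+ J' * 2 / eta)).
        rewrite ler_pM2r ?invr_gt0// ler_pM2r// ler_eXn2l ?ltr1n//.
        exact: ltnW.
      apply: lt_le_trans HN1 _; rewrite ler_nat /=.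
      by apply: leq_trans (leq_maxr N N1) _; exact/leqW/leqW.
    have kper x : cube x -> c0 * theta a x <=
        s * (periodized (Psi i0) j (dyadic_vec k) x * theta a x).
      move=> _; have [->|nz] := eqVneq (theta a x) 0; first by rewrite !mulr0.
      rewrite mulrA ler_wpM2r ?lattice_bump_ge0//; apply: Hk small _.
      exact: lattice_bump_near_lattice nz.
    have low : c0 * mass a <= `|pairing i0 k a|.
      rewrite /mass -Rintegral_cubeZ//.
      apply: le_trans (le_Rintegral_cube _ _ kper) _.
      - exact: cube_boundedZ.
      - by apply: cube_boundedZ; exact: cube_boundedM.
      rewrite Rintegral_cubeZ; last exact: cube_boundedM.
      by apply: le_trans (ler_norm _) _; rewrite normrM s1 mul1r.
    rewrite ler_wpM2l//; apply: le_trans low _.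
    rewrite (bigD1 i0)//= (bigD1 k)//= -addrA lerDl addr_ge0 ?sumr_ge0// => i _.
    exact: sumr_ge0.
  have cm0 : 0 < c0 * mass a by rewrite mulr_gt0.
  apply: (@lt_le_trans _ _ (\sum_(J1 <= j < J') V j a)); last first.
    have [h|/ltnW h] := leqP J1 J'; last by rewrite big_geq// sumr_ge0.
    rewrite (@big_cat_nat _ _ _ J1 J J')//= ?leq_maxl//.
    by rewrite lerDr sumr_ge0.
  apply: (@lt_le_trans _ _
    (\sum_(J1 <= j < J' | j == r %[mod q]) omega j * (c0 * mass a))).
    rewrite -mulr_suml; move: HJ'; rewrite ltr_pdivrMr// => HJ'.
    by rewrite mulrA ltr_pM2r.
  rewrite [leLHS]big_mkcond big_nat_cond [leRHS]big_nat_cond.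
  apply: ler_sum => j /andP[/andP[h1 h2] _]; case: ifPn => // /eqP jr.
  exact: Vlow.
have [tau Htau] := block_schedule K V0 mass_gt0 G_unbounded (0%N, 0, 0%N).
(* The signs attain [V j (tau j)]; a zero pairing receives the sign 1, so that every coefficient has
   modulus exactly [omega j]. *)
pose c : @wavelet_coefs R d := fun j i k =>
  omega j * (if 0 <= pairing i k (tau j) then 1 else -1).
have cE j i k : `|c j i k| = omega j.
  by rewrite /c normrM ger0_norm//; case: ifP; rewrite ?normrN normr1 mulr1.
have supc j : coefs_sup c j = omega j.
  rewrite /coefs_sup (_ : image _ _ = [set omega j]) ?sup1//.
  apply/seteqP; split => [_ [p _ <-]|_ ->] /=; first exact: cE.
  have j2 : (0 < 2 ^ j)%N by rewrite expn_gt0.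
  by exists (i0, [ffun=> Ordinal j2]) => //; exact: cE.
exists c; split => // -[U [oU [x Ux] pU [g gU cvgU]]].
pose w j a := \int[mu]_(x in cube) (wavelet_layer Psi c j x * theta a x).
have wV j a : `|w j a| <= V j a.
  rewrite /w layer_pairing /V mulr_sumr.
  apply: le_trans (ler_norm_sum _ _ _) _; apply: ler_sum => i _.
  rewrite mulr_sumr; apply: le_trans (ler_norm_sum _ _ _) _.
  by apply: ler_sum => k _; rewrite normrM cE.
have wK J a : `|\sum_(0 <= j < J) w j a| <= K J * mass a.
  rewrite /K mulr_sumr mulr_suml; apply: le_trans (ler_norm_sum _ _ _) _.
  apply: ler_sum => j _; rewrite /mass -Rintegral_cubeZ//.
  apply: norm_Rintegral_cube; [exact: cube_boundedM|exact: cube_boundedZ|].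
  move=> z _; rewrite normrM [X in _ * X]ger0_norm ?lattice_bump_ge0//.
  by rewrite ler_wpM2r ?lattice_bump_ge0// -supc; exact: HC.
have wtau j : w j (tau j) = V j (tau j).
  rewrite /w layer_pairing /V mulr_sumr; apply: eq_bigr => i _.
  rewrite mulr_sumr; apply: eq_bigr => k _; rewrite /c -mulrA; congr *%R.
  case: (lerP 0 (pairing i k (tau j))) => h; first by rewrite mul1r ger0_norm.
  by rewrite mulN1r ltr0_norm.
have [M HM] := Linfty_pairing oU gU.
have /(@nbhs_ballP _ _ x)[e /= e0 xeU] := open_nbhs_nbhs (conj oU Ux).
have e2 : 0 < e / 2 by rewrite divr_gt0.
(* A centre within [e / 2] of [x] and radii below [e / 2] keep the bumps, up to integer translation,
   in the ball around [x]; the periodicity of [U] does the rest. *)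
have [n [m xm]] := lattice_point_dense r y x q0 e2.
have [N HN] : exists N : nat, forall n, (N <= n)%N -> n.+2%:R^-1 < e / 2 :> R.
  have [N _ HN] := near_infty_natSinv_lt (PosNum e2).
  exists N => k Nk; exact: (HN k.+1 (leqW Nk)).
apply: (Htau w wV wK wtau (n, m, N) M) => a [/= a1 Na].
have aU : near_lattice a.1 a.2.+2%:R^-1 `<=` U.
  move=> z [l zl]; rewrite -(subrK (intvec l) z).
  suff : U (z - intvec l) by have := pU (z - intvec l) l; move=> ->.
  apply: xeU; rewrite -ball_normE /= distrC.
  apply: le_lt_trans (ler_distD a.1 _ _) _; rewrite [ltRHS]splitr.
  by apply: ltrD; [exact: le_lt_trans zl (HN _ Na)|rewrite a1].
exists (\int[mu]_(x in cube `&` U) (g x * theta a x)).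
  by apply: HM => // z; exact: lattice_bump_ge0.
have := cvgU _ (test_theta aU).
(* [wavelet_partial_sum] includes the scale [J] whereas the schedule sums over [j < J]: the two
   sequences differ by a shift. *)
rewrite (_ : (fun J => _) = fun J => \sum_(0 <= j < J.+1) w j a).
  by rewrite (cvg_shiftS (fun J => \sum_(0 <= j < J) w j a)).
by apply/funext => J; exact: partial_pairing.
Qed.

End nowhere_bounded.

Theorem proposition2p3 (R : realType) (d : nat) (hd : (0 < d)%N)
    (phi : 'rV[R]_d -> R) (Psi : 'I_(2 ^ d - 1) -> 'rV[R]_d -> R)
    (hPsi : smooth_wavelet_basis 0 phi Psi) :
  (forall c : @wavelet_coefs R d,
     (\sum_(0 <= j <oo) (coefs_sup c j)%:E < +oo)%E ->
     [/\ (\sum_(0 <= j <oo)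
            ereal_sup [set `|wavelet_layer Psi c j x|%:E | x in setT]
          < +oo)%E,
         forall x, cvgn (fun J => wavelet_partial_sum Psi c J x),
         exists M : R, forall x,
           `|limn (fun J => wavelet_partial_sum Psi c J x)| <= M
       & (forall i, continuous (Psi i)) ->
         continuous (fun x => limn (fun J => wavelet_partial_sum Psi c J x))])
  /\
  (forall omega : nat -> R,
     (forall j, 0 <= omega j) ->
     (\sum_(0 <= j <oo) (omega j)%:E = +oo)%E ->
     (forall i, piecewise_continuous (Psi i)) ->
     exists c : @wavelet_coefs R d,
       (forall j, coefs_sup c j = omega j) /\
       nowhere_locally_bounded (wavelet_partial_sum Psi c)).
Proof.
split; first by move=> c; exact: wavelet_series_normal_cvg hPsi c.
move=> omega o0 oinf pc.
(* Positive dimension provides at least one wavelet. *)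
have d1 : (0 < 2 ^ d - 1)%N by rewrite subn_gt0 -{1}(expn0 2) ltn_exp2l.
exact: (nowhere_bounded_series hPsi (i0 := Ordinal d1)).
Qed.
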